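(* Let $(W,S)$ be a Coxeter system (with $S$ finite). Then the language $\mathrm{Pal}\subset S^{*}$ of palindromic reduced words in $(W,S)$ is regular if and only if $W$ is the direct product of a finite Coxeter system with finitely many copies of the infinite dihedral group.
   Context: A Coxeter system $(W,S)$ consists of a group $W$ and a finite generating set $S$, determined by a symmetric function $m\colon S\times S\to\{1,2,3,\ldots\}\cup\{\infty\}$ with $m(s,s')=1$ if and only if $s=s'$; $W$ is the group generated by $S$ with defining relations $(ss')^{m(s,s')}=1$ for all $s,s'\in S$ with $m(s,s')\neq\infty$. Its Coxeter graph has vertex set $S$, an edge between distinct $s,s'$ whenever $m(s,s')\ge 3$, labelled by $m(s,s')$ when $m(s,s')\ge 4$. The infinite dihedral group is the Coxeter group with two generators $s,t$ and $m(s,t)=\infty$. A direct product of Coxeter systems corresponds to the disjoint union of their Coxeter graphs; so the condition says that each connected component of the Coxeter graph of $(W,S)$ either has finite Coxeter group or consists of two vertices joined by an edge labelled $\infty$ (the finite factor may be trivial and the number of infinite dihedral factors may be zero). $S^{*}$ denotes the free monoid on $S$; its elements are called words. A word $\mathbf{w}$ represents the element of $W$ that is the product of its letters; $|\mathbf{w}|$ is its number of letters. The length $\ell(w)$ of $w\in W$ is the minimum of $|\mathbf{w}|$ over all words representing $w$; a word $\mathbf{w}$ representing $w$ is reduced if $|\mathbf{w}|=\ell(w)$. A word is palindromic if it equals its reverse. $\mathrm{Pal}$ is the set of all words in $S^{*}$ that are both reduced and palindromic. A language over a finite alphabet is regular if it is exactly the set of words accepted by some deterministic finite automaton. *)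

(* Defs.v *)
From HB Require Import structures.
From mathcomp Require Import all_boot.

Set Implicit Arguments.
Unset Strict Implicit.
Unset Printing Implicit Defensive.

Local Open Scope group_scope.

Section Presentation.
Variable S : finType.

(* [None] stands for infinity. *)
Definition coxeter_matrix (m : S -> S -> option nat) : Prop :=
  [/\ forall s t, m s t = m t s,
      forall s t, m s t <> Some 0%N
    & forall s t, m s t = Some 1%N <-> s = t].

Definition coxeter_relations (m : S -> S -> option nat)
    (G : groupType) (f : S -> G) : Prop :=
  forall s t k, m s t = Some k -> (f s * f t) ^+ k = 1.

(* The generation clause needs no inverses because the relations include
   s ^+ 2 = 1; it also makes the extension phi unique. *)
Definition coxeter_presentation (m : S -> S -> option nat)
    (W : groupType) (g : S -> W) : Prop :=
  [/\ coxeter_relations m g,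
      forall x : W, exists w : seq S, \prod_(s <- w) g s = x
    & forall (G : groupType) (f : S -> G), coxeter_relations m f ->
        exists phi : UMagmaMorphism.type W G, forall s, phi (g s) = f s].

End Presentation.

Record coxeterSystem := CoxeterSystem {
  cox_group :> groupType;
  cox_index : finType;
  cox_m : cox_index -> cox_index -> option nat;
  cox_gen : cox_index -> cox_group;
  cox_matrixP : coxeter_matrix cox_m;
  cox_presentationP : coxeter_presentation cox_m cox_gen
}.

Section Length.
Variable C : coxeterSystem.

Definition word : Type := seq (cox_index C).

Definition word_elt (w : word) : C := \prod_(s <- w) cox_gen s.

Lemma represented_by_some_length (x : C) :
  exists n, [exists w : n.-tuple (cox_index C), word_elt w == x].
Proof.
have [_ gen _] := cox_presentationP C; have [w <-] := gen x.
by exists (size w); apply/existsP; exists (in_tuple w).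
Qed.

Definition cox_length (x : C) : nat := ex_minn (represented_by_some_length x).

Definition reduced (w : word) : bool := size w == cox_length (word_elt w).

Definition palindromic (w : word) : bool := rev w == w.

Definition Pal : pred word := [pred w | reduced w && palindromic w].

End Length.

Arguments Pal : clear implicits.

Record dfa (A : finType) := DFA {
  dfa_state : finType;
  dfa_start : dfa_state;
  dfa_final : pred dfa_state;
  dfa_trans : dfa_state -> A -> dfa_state
}.

Definition dfa_accepts (A : finType) (M : dfa A) (w : seq A) : bool :=
  dfa_final (foldl (@dfa_trans A M) (dfa_start M) w).

Definition regular (A : finType) (L : pred (seq A)) : Prop :=
  exists M : dfa A, forall w : seq A, L w = dfa_accepts M w.

Section DirectProduct.
Variables C D : coxeterSystem.

Definition prod_m (a b : (cox_index C + cox_index D)%type) : option nat :=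
  match a, b with
  | inl s, inl t => cox_m s t
  | inr s, inr t => cox_m s t
  | _, _ => Some 2%N
  end.

Definition prod_gen (a : (cox_index C + cox_index D)%type) : (C * D)%type :=
  match a with
  | inl s => (cox_gen s, 1)
  | inr t => (1, cox_gen t)
  end.

Lemma prod_matrixP : coxeter_matrix prod_m.
Proof.
have [symC nzC oneC] := cox_matrixP C; have [symD nzD oneD] := cox_matrixP D.
split=> [[s|s] [t|t]|[s|s] [t|t]|[s|s] [t|t]] //=.
- by split=> [/oneC ->|[<-]] //; apply/oneC.
- by split=> [/oneD ->|[<-]] //; apply/oneD.
Qed.

Lemma pair_prodE (I : Type) (r : seq I) (F : I -> (C * D)%type) :
  \prod_(i <- r) F i = (\prod_(i <- r) (F i).1, \prod_(i <- r) (F i).2).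
Proof. by elim/big_rec3: _ => // i x y _ _ ->. Qed.

Lemma pair_expgE (x : C) (y : D) k :
  ((x, y) : (C * D)%type) ^+ k = (x ^+ k, y ^+ k).
Proof. by elim: k => // k IHk; rewrite !expgS IHk. Qed.

Lemma commute_prod_words (I J : Type) (G : groupType) (f : I -> G) (g : J -> G)
    (u : seq I) (v : seq J) :
  (forall i j, commute (f i) (g j)) ->
  commute (\prod_(i <- u) f i) (\prod_(j <- v) g j).
Proof.
move=> fg; apply: commute_prod => j _; apply/commute_sym.
by apply: commute_prod => i _; apply/commute_sym.
Qed.

Lemma prod_presentationP : coxeter_presentation prod_m prod_gen.
Proof.
have [relC genC extC] := cox_presentationP C.
have [relD genD extD] := cox_presentationP D.
have [_ _ oneC] := cox_matrixP C; have [_ _ oneD] := cox_matrixP D.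
have sqC s : cox_gen s * cox_gen s = 1 :> C.
  by apply: (relC s s 1%N); apply/oneC.
have sqD s : cox_gen s * cox_gen s = 1 :> D.
  by apply: (relD s s 1%N); apply/oneD.
have pmul (x x' : C) (y y' : D) :
  ((x, y) : (C * D)%type) * (x', y') = (x * x', y * y') by [].
split.
- case=> [s|s] [t|t] k /=; rewrite pmul pair_expgE.
  + by move=> /relC ->; rewrite mul1g expg1n.
  + by case=> <-; rewrite !mulg1 !mul1g !expg2 sqC sqD.
  + by case=> <-; rewrite !mulg1 !mul1g !expg2 sqC sqD.
  + by move=> /relD ->; rewrite mul1g expg1n.
- case=> x y; have [u ux] := genC x; have [v vy] := genD y.
  exists (map inl u ++ map inr v); rewrite pair_prodE !big_cat !big_map /=.
  by rewrite ux vy !big1 // mulg1 mul1g.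
move=> G f relf.
have [p1 p1f] := extC G (f \o inl) (fun s t k => relf (inl s) (inl t) k).
have [p2 p2f] := extD G (f \o inr) (fun s t k => relf (inr s) (inr t) k).
have fV a : (f a)^-1 = f a.
  have prod_m1 : prod_m a a = Some 1%N.
    by have [_ _ one] := prod_matrixP; apply/one.
  exact/mulg1_eq/(relf a a 1%N).
have comf s t : commute (f (inl s)) (f (inr t)).
  have := relf (inl s) (inr t) 2%N erefl; rewrite expg2 => /mulg1_eq.
  by rewrite invgM !fV.
have comp x y : commute (p1 x) (p2 y).
  have [u <-] := genC x; have [v <-] := genD y.
  rewrite !gmulf_prod.
  by apply: commute_prod_words => s t; rewrite p1f p2f; apply: comf.
pose phi (z : (C * D)%type) := p1 z.1 * p2 z.2.
have phiM : {morph phi : x y / x * y}.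
  case=> x y [x' y']; rewrite /phi /= !gmulfM.
  by rewrite -!mulgA; congr (_ * _); rewrite !mulgA; congr (_ * _); apply: comp.
have phi1 : phi 1 = 1 by rewrite /phi !gmulf1 mulg1.
pose mixin := isUMagmaMorphism.Build (C * D)%type G phi (phi1, phiM).
pose phi' : UMagmaMorphism.type (C * D)%type G := HB.pack phi mixin.
exists phi'; case=> s; rewrite /= /phi /=.
- by rewrite gmulf1 mulg1 p1f.
- by rewrite gmulf1 mul1g p2f.
Qed.

Definition cox_prod : coxeterSystem :=
  CoxeterSystem prod_matrixP prod_presentationP.

Definition cox_isomorphic : Prop :=
  exists (phi : UMagmaMorphism.type C D) (f : cox_index C -> cox_index D),
    [/\ bijective phi, bijective f,
        forall s, phi (cox_gen s) = cox_gen (f s)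
      & forall s t, cox_m (f s) (f t) = cox_m s t].

End DirectProduct.

Definition finite_coxeter (C : coxeterSystem) : Prop :=
  exists r : seq C, forall x, x \in r.

Definition infinite_dihedral (C : coxeterSystem) : Prop :=
  #|cox_index C| = 2%N /\ forall s t : cox_index C, s <> t -> cox_m s t = None.

(* Main.v *)
From HB Require Import structures.
From mathcomp Require Import all_boot all_order all_algebra.
From mathcomp Require Import boolp reals Rstruct trigo zify ring lra.
Require Import Defs.

(** A reduced palindrome u r u^R is an expression of a reflection.  In the
    geometric representation it corresponds to a path that starts at the simple
    root of r and applies simple reflections s with B(alpha_s, beta) < 0 at the
    current root beta.  If a DFA accepts the reduced palindromes, then two words
    u, u' of the same length leading to the same state and with the same r
    coincide, because u r u'^R is accepted; so the number of such paths of length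
    n is bounded.

    In an infinite component a root is never dominant, hence every path can be
    prolonged; boundedness then forces deep roots to have exactly one ascent and
    exactly one descent.  Recording the values B(alpha_t, beta) along a path, deep
    states have one positive and one negative entry, which determines all labels
    of the component; running the path backwards, this shape persists down to the
    initial simple root alpha_o, where all neighbours of o are negative.  So o has
    only one neighbour, and an infinite component is a single edge labelled
    infinity.

    Conversely a reduced palindrome of even length is empty, so a reduced
    palindrome of a product lies in one of the factors. *)
Set Implicit Arguments.
Unset Strict Implicit.
Unset Printing Implicit Defensive.
Import Order.TTheory GRing.Theory Num.Theory.

(** * Groups, words and lengths *)

Local Open Scope group_scope.

(** With the inverse kept as data, the permutations of any type form a [groupType], hence a target
    for the universal property of a presentation. *)
Record bijection (T : Type) := Bijection {
  bij_fun :> T -> T;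
  bij_inv : T -> T;
  bijK : cancel bij_fun bij_inv;
  bijVK : cancel bij_inv bij_fun
}.

Section BijectionGroup.
Variable T : Type.
Implicit Types f g h : bijection T.

HB.instance Definition _ := gen_eqMixin (bijection T).
HB.instance Definition _ := gen_choiceMixin (bijection T).

Lemma bijection_ext f g : f =1 g -> f = g.
Proof.
case: f g => [f fV fK fVK] [g gV gK gVK] /= /funext fg.
have fgV : fV = gV by apply: funext => x; rewrite -{1}(gVK x) -fg fK.
move: fK fVK gK gVK; rewrite fg fgV => fK fVK gK gVK.
by congr Bijection; apply: Prop_irrelevance.
Qed.

Definition bij_one : bijection T := @Bijection T id id (frefl _) (frefl _).
Definition bij_mul f g : bijection T :=
  Bijection (can_comp (@bijK _ f) (@bijK _ g))
            (can_comp (@bijVK _ g) (@bijVK _ f)).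
Definition bij_opp f : bijection T := Bijection (@bijVK _ f) (@bijK _ f).

Lemma bij_mulA : associative bij_mul. Proof. by move=> *; apply: bijection_ext. Qed.
Lemma bij_mul1 : left_id bij_one bij_mul. Proof. by move=> *; apply: bijection_ext. Qed.
Lemma bij_mulr1 : right_id bij_one bij_mul. Proof. by move=> *; apply: bijection_ext. Qed.
Lemma bij_mulV : left_inverse bij_one bij_opp bij_mul.
Proof. by move=> f; apply: bijection_ext => x /=; rewrite bijK. Qed.
Lemma bij_mulrV : right_inverse bij_one bij_opp bij_mul.
Proof. by move=> f; apply: bijection_ext => x /=; rewrite bijVK. Qed.

HB.instance Definition _ := isGroup.Build (bijection T)
  bij_mulA bij_mul1 bij_mulr1 bij_mulV bij_mulrV.

Lemma bij_prodE (I : Type) (r : seq I) (F : I -> bijection T) x :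
  (\prod_(i <- r) F i) x = foldr (fun i => F i) x r.
Proof. by elim: r => [|i r IHr]; rewrite (big_nil, big_cons) //= -IHr. Qed.

Lemma bij_expE f n x : (f ^+ n) x = iter n f x.
Proof. by elim: n => // n IHn; rewrite expgS /= -IHn. Qed.

End BijectionGroup.

(** The universal property turns [f] into a homomorphism to the permutation group, so the effect of
    a word depends only on its element. *)
Lemma word_action (C : coxeterSystem) (T : Type) (f : cox_index C -> bijection T) :
  coxeter_relations (@cox_m C) f ->
  forall u v : word C, word_elt u = word_elt v ->
  forall x, foldr (fun s => f s) x u = foldr (fun s => f s) x v.
Proof.
move=> relf u v uv x; have [_ _ /(_ _ f relf)[phi phif]] := cox_presentationP C.
have := congr1 phi uv; rewrite /word_elt !gmulf_prod.
under eq_bigr do rewrite phif.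
under [RHS]eq_bigr do rewrite phif.
by move/(congr1 (fun g : bijection T => g x)); rewrite !bij_prodE.
Qed.

Section Words.
Variable C : coxeterSystem.
Implicit Types (s t : cox_index C) (x y : C) (u v w : word C).
Notation ell := (@cox_length C).
Notation gen := (@cox_gen C).

Lemma gen_sq s : gen s * gen s = 1.
Proof.
have [rel _ _] := cox_presentationP C; have [_ _ one] := cox_matrixP C.
by apply: (rel s s 1%N); apply/one.
Qed.

Lemma gen_inv s : (gen s)^-1 = gen s.
Proof. exact/mulg1_eq/gen_sq. Qed.

Lemma gen_mulK s x : x * gen s * gen s = x.
Proof. by rewrite -mulgA gen_sq mulg1. Qed.

Lemma gen_mulKV s x : gen s * (gen s * x) = x.
Proof. by rewrite mulgA gen_sq mul1g. Qed.

Lemma word_nil : word_elt [::] = 1 :> C. Proof. exact: big_nil. Qed.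

Lemma word_cons s u : word_elt (s :: u) = gen s * word_elt u.
Proof. exact: big_cons. Qed.

Lemma word_cat u v : word_elt (u ++ v) = word_elt u * word_elt v.
Proof. exact: big_cat. Qed.

Lemma word_rcons u s : word_elt (rcons u s) = word_elt u * gen s.
Proof. by rewrite -cats1 word_cat word_cons word_nil mulg1. Qed.

Lemma word_rev u : word_elt (rev u) = (word_elt u)^-1.
Proof.
elim: u => [|s u IHu]; first by rewrite word_nil invg1.
by rewrite rev_cons word_rcons word_cons invgM gen_inv IHu.
Qed.

Lemma ell_word u : ell (word_elt u) <= size u.
Proof.
rewrite /cox_length; case: ex_minnP => n _; apply.
by apply/existsP; exists (in_tuple u).
Qed.

Lemma reduced_word x : exists2 u, word_elt u = x & size u = ell x.
Proof.
rewrite /cox_length; case: ex_minnP => n /existsP[u /eqP ux] _.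
by exists u; rewrite ?size_tuple.
Qed.

Lemma ell1 : ell 1 = 0%N.
Proof. by apply/eqP; rewrite -leqn0 -word_nil ell_word. Qed.

Lemma ellM x y : ell (x * y) <= ell x + ell y.
Proof.
have [u <- <-] := reduced_word x; have [v <- <-] := reduced_word y.
by rewrite -word_cat -size_cat ell_word.
Qed.

Lemma ellV x : ell x^-1 = ell x.
Proof.
suff le y : ell y^-1 <= ell y by apply/eqP; rewrite eqn_leq le -{1}(invgK x) le.
by have [u <- <-] := reduced_word y; rewrite -word_rev -(size_rev u) ell_word.
Qed.

Lemma ell_gen_le s : ell (gen s) <= 1.
Proof. by have := ell_word [:: s]; rewrite word_cons word_nil mulg1. Qed.

(** The sign character: letting every generator act as negation on [bool] respects the relations,
    since a product of two generators then acts trivially. *)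
Lemma odd_word u v : word_elt u = word_elt v -> odd (size u) = odd (size v).
Proof.
pose f := Bijection negbK negbK.
have relf : coxeter_relations (@cox_m C) (fun=> f).
  move=> s t k _; have ->: f * f = 1 by apply: bijection_ext; apply: negbK.
  exact: expg1n.
have foldE (w : word C) : foldr (fun=> f : bool -> bool) false w = odd (size w).
  by elim: w => //= s w ->.
by move=> /(word_action relf)/(_ false); rewrite !foldE.
Qed.

Lemma odd_ell u : odd (ell (word_elt u)) = odd (size u).
Proof. by have [v vu <-] := reduced_word (word_elt u); apply: odd_word. Qed.

Lemma ell_gen_neq x s : ell (x * gen s) != ell x.
Proof.
have [u <- _] := reduced_word x; apply/eqP => /(congr1 odd).
by rewrite -word_rcons !odd_ell size_rcons /=; case: odd.
Qed.

Lemma ell_gen s : ell (gen s) = 1%N.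
Proof.
have := ell_gen_neq 1 s; rewrite mul1g ell1; have := ell_gen_le s.
by case: (ell (gen s)) => [|[]].
Qed.

Lemma ell_mulgen x s :
  ell (x * gen s) = if ell x < ell (x * gen s) then (ell x).+1 else (ell x).-1.
Proof.
have le1 := ellM x (gen s); have le2 := ellM (x * gen s) (gen s).
have := ell_gen_neq x s; rewrite gen_mulK !ell_gen in le1 le2 *.
by case: ifP; lia.
Qed.

Lemma ell_up x s : ell x < ell (x * gen s) -> ell (x * gen s) = (ell x).+1.
Proof. by move=> lt; rewrite ell_mulgen lt. Qed.

Lemma ell_down x s : ell (x * gen s) < ell x -> ell x = (ell (x * gen s)).+1.
Proof. by move=> lt; rewrite -{1}(gen_mulK s x) ell_up // gen_mulK. Qed.

Lemma ell_dichotomy x s : ell (x * gen s) < ell x \/ ell x < ell (x * gen s).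
Proof. by case: ltngtP (ell_gen_neq x s) => //; [left | right]. Qed.

Lemma last_descent x : x != 1 -> exists s, ell (x * gen s) < ell x.
Proof.
have [u] := reduced_word x; case/lastP: u => [<-|u s ux] sz; first by rewrite word_nil eqxx.
by exists s; rewrite -ux word_rcons gen_mulK -word_rcons ux -sz size_rcons ltnS ell_word.
Qed.

End Words.

Section Isomorphism.
Variables (C D : coxeterSystem) (f : cox_index C -> cox_index D).

Lemma cox_iso_of_matrix : bijective f ->
  (forall s t, cox_m (f s) (f t) = cox_m s t) -> cox_isomorphic C D.
Proof.
move=> bijf fm; case: (bijf) => g fK gK.
have gm s t : cox_m (g s) (g t) = cox_m s t by rewrite -fm !gK.
have [relC genC extC] := cox_presentationP C.
have [relD genD extD] := cox_presentationP D.
have [phi phif] : exists phi : UMagmaMorphism.type C D,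
    forall s, phi (cox_gen s) = cox_gen (f s).
  by apply: (extC D (fun s => cox_gen (f s))) => s t k mst; apply: relD; rewrite fm.
have [psi psif] : exists psi : UMagmaMorphism.type D C,
    forall s, psi (cox_gen s) = cox_gen (g s).
  by apply: (extD C (fun s => cox_gen (g s))) => s t k mst; apply: relC; rewrite gm.
exists phi, f; split=> //; exists psi => x.
  have [u <-] := genC x; rewrite !gmulf_prod.
  by apply: eq_bigr => s _; rewrite phif psif fK.
have [u <-] := genD x; rewrite !gmulf_prod.
by apply: eq_bigr => s _; rewrite psif phif gK.
Qed.

End Isomorphism.

(* Two words are identified when every group satisfying the relations does so;
   impredicativity of Prop makes this the presented group itself. *)
Section Construction.
Variables (S : finType) (m : S -> S -> option nat).
Hypothesis mP : coxeter_matrix m.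
Implicit Types u v w : seq S.

Definition cox_equiv u v : bool := `[< forall (G : groupType) (f : S -> G),
  coxeter_relations m f -> \prod_(s <- u) f s = \prod_(s <- v) f s >].

Lemma cox_equivP u v : reflect (forall (G : groupType) (f : S -> G),
  coxeter_relations m f -> \prod_(s <- u) f s = \prod_(s <- v) f s) (cox_equiv u v).
Proof. exact: asboolP. Qed.

Lemma cox_equiv_refl : reflexive cox_equiv.
Proof. by move=> u; apply/cox_equivP. Qed.

Lemma cox_equiv_sym : symmetric cox_equiv.
Proof. by move=> u v; apply/cox_equivP/cox_equivP => uv G f /uv. Qed.

Lemma cox_equiv_trans : transitive cox_equiv.
Proof.
move=> v u w /cox_equivP uv /cox_equivP vw; apply/cox_equivP => G f relf.
by rewrite uv // vw.
Qed.

Definition cox_equiv_rel := EquivRel cox_equiv cox_equiv_refl cox_equiv_sym cox_equiv_trans.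

Local Notation quot := {eq_quot cox_equiv_rel}%qT.

Definition presented : Type := quot.
HB.instance Definition _ := Choice.on presented.

Definition class_of u : presented := (\pi_({eq_quot cox_equiv_rel}) u)%qT.

Lemma class_ofP u v : reflect (class_of u = class_of v) (cox_equiv u v).
Proof. exact: (@eqmodP _ cox_equiv_rel). Qed.

Lemma class_ofK x : class_of (repr (x : quot)) = x.
Proof. exact: reprK. Qed.

Lemma repr_class u : cox_equiv (repr (class_of u : quot)) u.
Proof. by apply/class_ofP; rewrite class_ofK. Qed.

Definition pmul (x y : presented) : presented :=
  class_of (repr (x : quot) ++ repr (y : quot)).
Definition pinv (x : presented) : presented :=
  class_of (rev (repr (x : quot))).

Lemma pmulE u v : pmul (class_of u) (class_of v) = class_of (u ++ v).
Proof.
apply/class_ofP/cox_equivP => G f relf; rewrite !big_cat /=.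
by congr (_ * _); apply: (cox_equivP _ _ (repr_class _)).
Qed.

Lemma rel_sq (G : groupType) (f : S -> G) s : coxeter_relations m f -> f s * f s = 1.
Proof. by case: mP => _ _ one relf; apply: (relf s s 1%N); apply/one. Qed.

Lemma prod_rev (G : groupType) (f : S -> G) u : coxeter_relations m f ->
  \prod_(s <- rev u) f s = (\prod_(s <- u) f s)^-1.
Proof.
move=> relf; elim: u => [|s u IHu]; first by rewrite !big_nil invg1.
rewrite rev_cons big_rcons big_cons /= invgM IHu; congr (_ * _).
by apply/esym/mulg1_eq/rel_sq.
Qed.

Lemma pinvE u : pinv (class_of u) = class_of (rev u).
Proof.
apply/class_ofP/cox_equivP => G f relf; rewrite !prod_rev //; congr _^-1.
exact: (cox_equivP _ _ (repr_class _)).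
Qed.

Lemma pmulA : associative pmul.
Proof.
by move=> x y z; rewrite -(class_ofK x) -(class_ofK y) -(class_ofK z) !pmulE catA.
Qed.

Lemma pmul1 : left_id (class_of [::]) pmul.
Proof. by move=> x; rewrite -(class_ofK x) pmulE. Qed.

Lemma pmulr1 : right_id (class_of [::]) pmul.
Proof. by move=> x; rewrite -(class_ofK x) pmulE cats0. Qed.

Lemma pmulV : left_inverse (class_of [::]) pinv pmul.
Proof.
move=> x; rewrite -(class_ofK x) pinvE pmulE; apply/class_ofP/cox_equivP => G f relf.
by rewrite big_cat prod_rev //= mulVg big_nil.
Qed.

Lemma pmulrV : right_inverse (class_of [::]) pinv pmul.
Proof.
move=> x; rewrite -(class_ofK x) pinvE pmulE; apply/class_ofP/cox_equivP => G f relf.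
by rewrite big_cat prod_rev //= mulgV big_nil.
Qed.

HB.instance Definition _ := isGroup.Build presented pmulA pmul1 pmulr1 pmulV pmulrV.

Lemma class_ofM u v : (class_of u : presented) * class_of v = class_of (u ++ v).
Proof. exact: pmulE. Qed.

Lemma class_of_prod u : \prod_(s <- u) class_of [:: s] = class_of u.
Proof. by elim: u => [|s u IHu]; rewrite (big_nil, big_cons) // IHu class_ofM. Qed.

Lemma presentedP : coxeter_presentation m (fun s => class_of [:: s] : presented).
Proof.
split.
- move=> s t k mst; rewrite class_ofM /=.
  have -> : (class_of [:: s; t] : presented) ^+ k = class_of (flatten (nseq k [:: s; t])).
    elim: k {mst} => [|k IHk]; first by rewrite expg0.
    by rewrite expgS IHk class_ofM.
  apply/class_ofP/cox_equivP => G f relf; rewrite big_nil -[RHS](relf _ _ _ mst).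
  elim: k {mst} => [|k IHk]; first by rewrite big_nil expg0.
  by rewrite expgS /= !big_cons IHk mulgA.
- by move=> x; exists (repr (x : quot)); rewrite class_of_prod class_ofK.
move=> G f relf.
pose phi (x : presented) := \prod_(s <- repr (x : quot)) f s.
have phiE u : phi (class_of u) = \prod_(s <- u) f s.
  exact: (cox_equivP _ _ (repr_class _)).
have phiM : (phi 1 = 1) * {morph phi : x y / x * y}.
  split=> [|x y]; first by rewrite [LHS]phiE big_nil.
  by rewrite -(class_ofK x) -(class_ofK y) class_ofM !phiE big_cat.
pose mixin := isUMagmaMorphism.Build presented G phi phiM.
pose phi' : UMagmaMorphism.type presented G := HB.pack phi mixin.
by exists phi' => s; rewrite /= phiE big_cons big_nil mulg1.
Qed.

Definition presented_system : coxeterSystem := CoxeterSystem mP presentedP.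

End Construction.

Close Scope group_scope.

(** * The geometric representation *)

Local Open Scope ring_scope.

Section Chebyshev.
Variable R : realFieldType.
Implicit Types c p q : R.

(** The recurrence u(j+2) = c u(j+1) - u(j) started at [q], [p]. For [q = 0], [p = 1] and c = 2 cos
    x it gives sin (j x) / sin x, a Chebyshev polynomial of the second kind in cos x. *)
Fixpoint cheb c q p (j : nat) : R := if j is j'.+1 then cheb c p (c * p - q) j' else q.

Lemma chebS c q p j : cheb c q p j.+2 = c * cheb c q p j.+1 - cheb c q p j.
Proof. by elim: j q p => // j IHj q p; apply: IHj. Qed.

Lemma cheb_shift c q p m j :
  cheb c q p (m + j) = cheb c (cheb c q p m) (cheb c q p m.+1) j.
Proof. by elim: m q p => // m IHm q p; apply: IHm. Qed.

Lemma chebE c q p j : cheb c q p j.+1 = p * cheb c 0 1 j.+1 - q * cheb c 0 1 j.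
Proof.
suff: cheb c q p j.+1 = p * cheb c 0 1 j.+1 - q * cheb c 0 1 j /\
      cheb c q p j.+2 = p * cheb c 0 1 j.+2 - q * cheb c 0 1 j.+1 by case.
elim: j => [|j [IH1 IH2]]; first by split=> /=; ring.
by split=> //; rewrite chebS IH1 IH2 (chebS _ 0 1 j.+1) (chebS _ 0 1 j); ring.
Qed.

(** A shift by [m.+1] plays the role of a half turn. Every solution is a combination of [cheb c 0 1]
    and its shift, so the half turn negates all of them. *)
Lemma cheb_antiperiod c q p m : cheb c 0 1 m.+1 = 0 -> cheb c 0 1 m.+2 = -1 ->
  cheb c q p m.+1 = - q /\ cheb c q p m.+2 = - p.
Proof.
move=> U0 U1; have Um : cheb c 0 1 m = 1 by have := chebS c 0 1 m; rewrite U0 U1; lra.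
by rewrite (chebE c q p m) (chebE c q p m.+1) U0 U1 Um; split; ring.
Qed.

End Chebyshev.

(* [a s t] stands for twice the standard form on the simple roots, that is
   [- 2 cos (pi / m s t)], or [- 2] when [m s t] is infinite. *)
Record cartan (R : realFieldType) (S : finType) (m : S -> S -> option nat)
    (a : S -> S -> R) : Prop := Cartan {
  cartan_sym : forall s t, a s t = a t s;
  cartan_diag : forall s, a s s = 2;
  cartan_le0 : forall s t, s != t -> a s t <= 0;
  cartan_eq0 : forall s t, s != t -> a s t = 0 <-> m s t = Some 2;
  cartan_gt : forall s t k, s != t -> m s t = Some k.+1 -> -2 < a s t;
  cartan_cheb0 : forall s t k, s != t -> m s t = Some k.+1 ->
    cheb (- a s t) 0 1 k.+1 = 0 /\ cheb (- a s t) 0 1 k.+2 = -1;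
  cartan_cheb_ge0 : forall s t j, s != t ->
    (forall k, m s t = Some k -> (j <= k)%N) -> 0 <= cheb (- a s t) 0 1 j
}.

Section Adjacency.
Variables (R : realFieldType) (S : finType) (m : S -> S -> option nat) (a : S -> S -> R).
Hypothesis aP : cartan m a.

Definition adj s t : bool := (s != t) && (a s t != 0).

Lemma adj_sym : symmetric adj.
Proof. by move=> s t; rewrite /adj eq_sym (cartan_sym aP). Qed.

Lemma adj_lt0 s t : adj s t -> a s t < 0.
Proof. by case/andP=> st a0; rewrite lt_neqAle a0 (cartan_le0 aP). Qed.

Lemma adj_connect_sym : connect_sym adj.
Proof. exact/sym_connect_sym/adj_sym. Qed.

End Adjacency.

Section Geometric.
Variables (R : realFieldType) (C : coxeterSystem).
Local Notation S := (cox_index C).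
Variable a : S -> S -> R.
Hypothesis aP : cartan (@cox_m C) a.
Local Notation V := {ffun S -> R^o}.
Local Notation ell := (@cox_length C).
Local Notation gen := (@cox_gen C).
Implicit Types (s t r : S) (x y z : V) (u v : word C) (g h : C).

(** The pairing with the simple root of [s] (see [form_sroot]). Simple roots have norm 2, so [refl]
    is the orthogonal reflection without a denominator. *)
Definition coord s x : R := \sum_t a s t * (x t : R).
Definition sroot s : V := [ffun t => (t == s)%:R].
Definition refl s x : V := x - coord s x *: sroot s.
Definition form x y : R := \sum_s (x s : R) * coord s y.

Lemma vecD x y s : (x + y) s = x s + y s :> R. Proof. by rewrite ffunE. Qed.
Lemma vecN x s : (- x) s = - x s :> R. Proof. by rewrite ffunE. Qed.
Lemma vecZ k x s : (k *: x) s = k * x s :> R. Proof. by rewrite ffunE. Qed.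
Lemma srootE s t : sroot s t = (t == s)%:R :> R. Proof. by rewrite ffunE. Qed.

Lemma coordD s x y : coord s (x + y) = coord s x + coord s y.
Proof. by rewrite /coord -big_split; apply: eq_bigr => t _; rewrite vecD mulrDr. Qed.

Lemma coordZ s k x : coord s (k *: x) = k * coord s x.
Proof.
by rewrite /coord mulr_sumr; apply: eq_bigr => t _; rewrite vecZ mulrCA.
Qed.

Lemma coordN s x : coord s (- x) = - coord s x.
Proof. by rewrite -scaleN1r coordZ mulN1r. Qed.

Lemma coord_sroot s t : coord s (sroot t) = a s t.
Proof.
rewrite /coord (bigD1 t) //= srootE eqxx mulr1 big1 ?addr0 // => r /negPf rt.
by rewrite srootE rt mulr0.
Qed.

Lemma reflE s x t : refl s x t = x t - coord s x * (t == s)%:R :> R.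
Proof. by rewrite vecD vecN vecZ srootE. Qed.

Lemma refl_neq s x t : t != s -> refl s x t = x t.
Proof. by move=> /negPf ts; rewrite reflE ts mulr0 subr0. Qed.

Lemma refl_eq s x : refl s x s = x s - coord s x.
Proof. by rewrite reflE eqxx mulr1. Qed.

Lemma coord_refl t s x : coord t (refl s x) = coord t x - a t s * coord s x.
Proof. by rewrite /refl -scaleNr coordD coordZ coord_sroot mulNr mulrC. Qed.

Lemma coord_refl_same s x : coord s (refl s x) = - coord s x.
Proof. by rewrite coord_refl (cartan_diag aP); ring. Qed.

Lemma reflD s x y : refl s (x + y) = refl s x + refl s y.
Proof. by rewrite /refl coordD scalerDl opprD addrACA. Qed.

Lemma reflZ s k x : refl s (k *: x) = k *: refl s x.
Proof. by rewrite /refl coordZ -scalerA -scalerBr. Qed.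

Lemma refl_fix s x : coord s x = 0 -> refl s x = x.
Proof. by rewrite /refl => ->; rewrite scale0r subr0. Qed.

Lemma reflK s : involutive (refl s).
Proof.
by move=> x; rewrite {1}/refl coord_refl_same scaleNr opprK /refl subrK.
Qed.

Lemma refl_sroot s : refl s (sroot s) = - sroot s.
Proof. by rewrite /refl coord_sroot (cartan_diag aP) scaler_nat mulr2n opprD addNKr. Qed.

Lemma refl_pair s t p q : s != t ->
  refl t (p *: sroot s + q *: sroot t) = p *: sroot s + (- a s t * p - q) *: sroot t.
Proof.
move=> st; rewrite /refl -addrA coordD !coordZ !coord_sroot (cartan_diag aP) -scalerBl.
by congr (_ + _ *: _); rewrite (cartan_sym aP t s); ring.
Qed.

Definition refl_bij s : bijection V := Bijection (@reflK s) (@reflK s).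

(** For a finite label of distinct [s], [t], a vector splits into a part in the plane of the two
    simple roots and a part orthogonal to both. The product of the reflections fixes the latter; on
    the former, its power given by the label amounts to two half turns of [cheb]. *)
Lemma refl_relations : coxeter_relations (@cox_m C) refl_bij.
Proof.
move=> s t k mst; apply: bijection_ext => x; rewrite bij_expE /=.
pose g z := refl s (refl t z); rewrite -/g.
have [_ nz one] := cox_matrixP C.
have [st|st] := eqVneq s t.
  rewrite -st in mst g *; have /one ms : s = s by [].
  by move: mst; rewrite ms => -[<-] /=; rewrite /g reflK.
case: k mst => [/nz//|k mst].
have gD z z' : g (z + z') = g z + g z' by rewrite /g !reflD.
have iterD n z z' : iter n g (z + z') = iter n g z + iter n g z'.
  by elim: n => //= n ->; rewrite gD.
have [U0 U1] := cartan_cheb0 aP st mst; set c := - a s t in U0 U1.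
(* Each application of [g] advances the two coefficients by two steps of the recurrence. *)
have iter_pair n q p : iter n g (p *: sroot s + q *: sroot t) =
    cheb c q p (n + n).+1 *: sroot s + cheb c q p (n + n) *: sroot t.
  elim: n => [//|n IHn]; rewrite iterS IHn addSn addnS /g refl_pair // -/c -chebS.
  rewrite addrC refl_pair 1?eq_sym // (cartan_sym aP) -/c -chebS.
  by rewrite addrC.
have iter_fix n z : coord s z = 0 -> coord t z = 0 -> iter n g z = z.
  by move=> sz tz; elim: n => //= n ->; rewrite /g !refl_fix // refl_fix.
(* The Gram determinant of the two simple roots; [p] and [q] below are Cramer's rule for the
   component of [x] in their plane. *)
pose d := 4 - a s t * a s t.
have d_neq0 : d != 0.
  have := cartan_gt aP st mst; have := cartan_le0 aP st; move=> h1 h2.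
  by rewrite gt_eqF // /d; nra.
pose p := (2 * coord s x - a s t * coord t x) / d.
pose q := (2 * coord t x - a s t * coord s x) / d.
have ts : a t s = a s t by rewrite (cartan_sym aP).
have -> : x = (x - (p *: sroot s + q *: sroot t)) + (p *: sroot s + q *: sroot t).
  by rewrite subrK.
rewrite iterD iter_pair iter_fix.
- congr (_ + _).
  have [A1 A2] := cheb_antiperiod q p U0 U1.
  have [B1 B2] := cheb_antiperiod (- q) (- p) U0 U1.
  by rewrite -addnS !cheb_shift A1 A2 B1 B2 !opprK.
- rewrite coordD coordN coordD !coordZ !coord_sroot (cartan_diag aP) /p /q /d.
  by field.
- rewrite coordD coordN coordD !coordZ !coord_sroot (cartan_diag aP) ts /p /q /d.
  by field.
Qed.

Definition acts u x : V := foldr refl x u.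

Lemma acts_eq u v x : word_elt u = word_elt v -> acts u x = acts v x.
Proof. by move=> uv; apply: (word_action refl_relations uv). Qed.

Lemma word_of_subproof g : exists u : word C, word_elt u = g.
Proof. by have [_ gen_ _] := cox_presentationP C; apply: gen_. Qed.

Definition word_of g : word C := sval (cid (word_of_subproof g)).

Lemma word_ofK g : word_elt (word_of g) = g.
Proof. by rewrite /word_of; case: cid. Qed.

Definition act g x : V := acts (word_of g) x.

Lemma act_word u x : act (word_elt u) x = acts u x.
Proof. by apply: acts_eq; rewrite word_ofK. Qed.

Lemma acts_cat u v x : acts (u ++ v) x = acts u (acts v x).
Proof. exact: foldr_cat. Qed.

Lemma actM g h x : act (g * h)%g x = act g (act h x).
Proof. by rewrite -(word_ofK g) -(word_ofK h) -word_cat !act_word acts_cat. Qed.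

Lemma act1 x : act 1%g x = x.
Proof. by rewrite -(word_nil C) act_word. Qed.

Lemma act_gen s x : act (gen s) x = refl s x.
Proof. by have := act_word [:: s] x; rewrite word_cons word_nil mulg1. Qed.

Lemma actK g x : act g^-1%g (act g x) = x.
Proof. by rewrite -actM mulVg act1. Qed.

Lemma actKV g x : act g (act g^-1%g x) = x.
Proof. by rewrite -actM mulgV act1. Qed.

Lemma actsD u x y : acts u (x + y) = acts u x + acts u y.
Proof. by elim: u => //= s u ->; rewrite reflD. Qed.

Lemma actsZ u k x : acts u (k *: x) = k *: acts u x.
Proof. by elim: u => //= s u ->; rewrite reflZ. Qed.

Lemma actD g x y : act g (x + y) = act g x + act g y.
Proof. exact: actsD. Qed.

Lemma actZ g k x : act g (k *: x) = k *: act g x.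
Proof. exact: actsZ. Qed.

Lemma actN g x : act g (- x) = - act g x.
Proof. by rewrite -!scaleN1r actZ. Qed.

Lemma form_sym x y : form x y = form y x.
Proof.
rewrite /form /coord; under eq_bigr do rewrite mulr_sumr.
rewrite exchange_big; apply: eq_bigr => s _; rewrite mulr_sumr.
by apply: eq_bigr => t _; rewrite (cartan_sym aP) mulrC -mulrA mulrCA.
Qed.

Lemma formDr x y z : form x (y + z) = form x y + form x z.
Proof. by rewrite /form -big_split; apply: eq_bigr => s _; rewrite coordD mulrDr. Qed.

Lemma formZr x k y : form x (k *: y) = k * form x y.
Proof. by rewrite /form mulr_sumr; apply: eq_bigr => s _; rewrite coordZ mulrCA. Qed.

Lemma form_sroot s x : form (sroot s) x = coord s x.
Proof.
rewrite /form (bigD1 s) //= srootE eqxx mul1r big1 ?addr0 // => t /negPf ts.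
by rewrite srootE ts mul0r.
Qed.

Lemma form_refl s x y : form (refl s x) y = form x (refl s y).
Proof.
rewrite form_sym /refl -!scaleNr !formDr !formZr !(form_sym _ (sroot s)) !form_sroot.
by rewrite form_sym; ring.
Qed.

Lemma form_act g x y : form (act g x) (act g y) = form x y.
Proof.
rewrite /act; elim: (word_of g) => //= s u <-.
by rewrite form_refl reflK.
Qed.

Lemma form_root g s : form (act g (sroot s)) (act g (sroot s)) = 2.
Proof. by rewrite form_act form_sroot coord_sroot (cartan_diag aP). Qed.

Definition reflection g s : C := (g * gen s * g^-1)%g.

Lemma reflectionE g s x : act (reflection g s) x =
  x - form (act g (sroot s)) x *: act g (sroot s).
Proof.
rewrite /reflection !actM act_gen /refl -scaleNr actD actKV actZ scaleNr.
by rewrite -form_sroot -(form_act g) actKV.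
Qed.

Lemma reflectionV g s : ((reflection g s)^-1 = reflection g s)%g.
Proof. by rewrite /reflection !invgM invgK gen_inv mulgA. Qed.

Lemma reflection_conj t g s : (gen t * reflection g s * gen t)%g = reflection (gen t * g)%g s.
Proof. by rewrite /reflection invgM gen_inv !mulgA. Qed.

Definition pos x : bool := [forall s, 0 <= (x s : R)].

Lemma posP x : reflect (forall s, 0 <= (x s : R)) (pos x).
Proof. by apply: (iffP forallP). Qed.

Lemma posD x y : pos x -> pos y -> pos (x + y).
Proof. by move=> /posP x0 /posP y0; apply/posP => s; rewrite vecD addr_ge0. Qed.

Lemma posZ k x : 0 <= k -> pos x -> pos (k *: x).
Proof. by move=> k0 /posP x0; apply/posP => s; rewrite vecZ mulr_ge0. Qed.

Lemma pos_sroot s : pos (sroot s).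
Proof. by apply/posP => t; rewrite srootE ler0n. Qed.

Lemma pos_neg_eq0 x : pos x -> pos (- x) -> x = 0.
Proof.
move=> /posP x0 /posP Nx0; apply/ffunP => s; rewrite [RHS]ffunE.
by have := x0 s; have := Nx0 s; rewrite vecN => h1 h2; apply/eqP; rewrite eq_le h2 andbT; lra.
Qed.

Lemma root_neq0 g s : act g (sroot s) != 0.
Proof.
apply/eqP => g0; have := form_root g s; rewrite g0.
by rewrite -(scale0r (0 : V)) formZr mul0r; lra.
Qed.

Section Alternating.
Variables r s : S.
Hypothesis rs : r != s.

(** Built from the right: the last letter is always [r], and the parity of [k] decides the first
    one. *)
Fixpoint altw (r s : S) (k : nat) : word C :=
  if k is k'.+1 then (if odd k' then s else r) :: altw r s k' else [::].

Lemma size_altw r' s' k : size (altw r' s' k) = k.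
Proof. by elim: k => //= k ->. Qed.

Lemma altw_split r' s' n k : exists2 u, altw r' s' (n + k) = u ++ altw r' s' k & size u = n.
Proof.
elim: n => [|n [u uE un]]; first by exists [::].
by exists ((if odd (n + k) then s' else r') :: u); rewrite ?addSn /= ?uE ?un.
Qed.

Lemma altw_rcons r' s' k : altw r' s' k.+1 = rcons (altw s' r' k) r'.
Proof. by elim: k => //= k <-; case: odd. Qed.

Lemma altw_even j : word_elt (altw r s (j + j)) = ((gen s * gen r) ^+ j)%g.
Proof.
elim: j => [|j IHj]; first by rewrite expg0 word_nil.
rewrite addSn addnS /= addnn odd_double /= -addnn !word_cons IHj expgS.
by rewrite !mulgA.
Qed.

End Alternating.

(** The defining relation in braid form. For even [k] the two sides are powers of [gen s * gen r]
    and of its inverse; for odd [k] one generator is split off first. *)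
Lemma altw_braid r s k : cox_m r s = Some k -> word_elt (altw r s k) = word_elt (altw s r k).
Proof.
move=> mrs; have [rel _ _] := cox_presentationP C; have relrs := rel _ _ _ mrs.
have [sym _ _] := cox_matrixP C.
have relsr : ((gen s * gen r) ^+ k = 1)%g by apply: rel; rewrite sym.
have [j [kE|kE]] : exists j, k = (j + j)%N \/ k = (j + j).+1.
  by exists k./2; have := odd_double_half k; case: odd; lia.
  rewrite kE !altw_even; rewrite kE in relrs.
  apply/divg1_eq; rewrite -expVgn invgM !gen_inv -expgnDr //.
    by rewrite -kE.
rewrite kE [in RHS]altw_rcons /= addnn odd_double -addnn word_cons word_rcons !altw_even.
rewrite kE in relrs.
apply/divg1_eq; rewrite invgM gen_inv -expVgn invgM !gen_inv.
have shift n : (gen r * (gen s * gen r) ^+ n * gen s = (gen r * gen s) ^+ n.+1)%g.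
  elim: n => [|n IHn]; first by rewrite expg0 mulg1 expg1.
  by rewrite expgS expgS -IHn !mulgA.
by rewrite mulgA shift -expgnDr addSn.
Qed.

Lemma acts_altw r s k : r != s ->
  acts (altw r s k) (sroot s) =
    cheb (- a r s) 0 1 k.+1 *: sroot (if odd k then r else s) +
    cheb (- a r s) 0 1 k *: sroot (if odd k then s else r).
Proof.
move=> rs; elim: k => [|k IHk]; first by rewrite /= scale0r addr0 scale1r.
have sr : s != r by rewrite eq_sym.
rewrite [acts _ _]/= IHk chebS addrC /=; case: (odd k) => /=.
  by rewrite addrC refl_pair // addrC.
by rewrite addrC refl_pair // (cartan_sym aP) addrC.
Qed.

(** The inequality is strict because the coefficient of index [k.+1] occurs, and nonnegativity is
    known only up to the label. *)
Lemma pos_altw r s k : r != s -> (forall m, cox_m r s = Some m -> (k < m)%N) ->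
  exists p q, [/\ 0 <= p, 0 <= q & acts (altw r s k) (sroot s) = p *: sroot r + q *: sroot s].
Proof.
move=> rs km; rewrite acts_altw //.
have h1 := cartan_cheb_ge0 aP rs km.
have h2 : 0 <= cheb (- a r s) 0 1 k by apply: (cartan_cheb_ge0 aP rs) => m /km/ltnW.
by case: odd; [exists (cheb (- a r s) 0 1 k.+1), (cheb (- a r s) 0 1 k)
  | exists (cheb (- a r s) 0 1 k), (cheb (- a r s) 0 1 k.+1)]; split=> //; rewrite addrC.
Qed.

(** Induction on length. Strip from [g] a maximal alternating suffix in [r] and [s], where [r] is a
    last descent. The rest [v] ascends along both letters, so it makes both simple roots positive,
    and the suffix sends the simple root of [s] to a nonnegative combination of the two. *)
Lemma act_pos g s : (ell g < ell (g * gen s)%g)%N -> pos (act g (sroot s)).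
Proof.
have [n] := ubnP (ell g); elim: n g s => // n IHn g s gn gs.
have [->|g1] := eqVneq g 1%g; first by rewrite act1 pos_sroot.
have [r gr] := last_descent g1.
have rs : r != s by apply/eqP => rs; move: gr gs; rewrite rs; lia.
pose P k := ((k <= ell g)%N && (ell (g * (word_elt (altw r s k))^-1)%g + k == ell g)%N).
have P1 : P 1%N.
  rewrite /P /= word_cons word_nil mulg1 gen_inv.
  by have := ell_down gr; lia.
have Pb k : P k -> (k <= ell g)%N by case/andP.
have exP : exists k, P k by exists 1%N.
have [[|k] /andP[kg /eqP vk] kmax] := ex_maxnP exP Pb.
  by have := kmax _ P1.
set v := (g * _)%g in vk.
have gE : g = (v * word_elt (altw r s k.+1))%g by rewrite /v mulgVK.
have vlt : (ell v < n)%N by lia.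
(* A descent here would extend the suffix, against its maximality. *)
have out : (ell v < ell (v * gen (if odd k.+1 then s else r)))%N.
  have [lt|//] := ell_dichotomy v (if odd k.+1 then s else r).
  have vE : (g * (word_elt (altw r s k.+2))^-1)%g = (v * gen (if odd k.+1 then s else r))%g.
    by rewrite /v [altw r s k.+2]/= word_cons invgM gen_inv mulgA.
  have := ell_down lt => vd.
  have /kmax : P k.+2 by rewrite /P vE; lia.
  by rewrite ltnn.
(* A descent along the first letter of the suffix would give [g] an expression that is too short. *)
have inn : (ell v < ell (v * gen (if odd k then s else r)))%N.
  have [lt|//] := ell_dichotomy v (if odd k then s else r).
  have := ellM (v * gen (if odd k then s else r)) (word_elt (altw r s k)).
  have := ell_word (altw r s k); rewrite size_altw.
  have -> : (v * gen (if odd k then s else r) * word_elt (altw r s k) = g)%g.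
    by rewrite gE /= word_cons mulgA.
  by have := ell_down lt; lia.
have vr : pos (act v (sroot r)).
  by apply: IHn => //; move: inn out => /=; case: odd.
have vs : pos (act v (sroot s)).
  by apply: IHn => //; move: inn out => /=; case: odd.
(* Otherwise the end of the suffix could be braided so as to end in [s], making [s] a descent of
   [g]. *)
have km m : cox_m r s = Some m -> (k.+1 < m)%N.
  move=> mrs; rewrite ltnNge; apply/negP => mk.
  have [_ nz _] := cox_matrixP C.
  have [m' mE] : exists m', m = m'.+1 by case: m mrs {mk} => [/nz//|m' _]; exists m'.
  have [u uE un] := altw_split r s (k.+1 - m) m; rewrite subnK // in uE.
  move: gs; rewrite ltnNge => /negP[].
  have -> : (g * gen s = v * word_elt u * word_elt (altw r s m'))%g.
    rewrite {1}gE uE word_cat (altw_braid mrs) mE altw_rcons word_rcons.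
    by rewrite !mulgA gen_mulK.
  rewrite (leq_trans (ellM _ _)) //.
  have := ellM v (word_elt u); have := ell_word u; have := ell_word (altw r s m').
  by rewrite size_altw; lia.
have [p [q [p0 q0 E]]] := pos_altw rs km.
by rewrite gE actM act_word E actD !actZ posD ?posZ.
Qed.

Lemma act_neg g s : (ell (g * gen s)%g < ell g)%N -> pos (- act g (sroot s)).
Proof.
move=> gs; rewrite -actN -refl_sroot -act_gen -actM.
by apply: act_pos; rewrite gen_mulK.
Qed.

Lemma act_posE g s : pos (act g (sroot s)) = (ell g < ell (g * gen s)%g)%N.
Proof.
apply/idP/idP => [gs|]; last exact: act_pos.
have [/act_neg gs'|//] := ell_dichotomy g s.
by have := pos_neg_eq0 gs gs'; move/eqP; rewrite (negPf (root_neq0 g s)).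
Qed.

Lemma root_sign g s : pos (act g (sroot s)) \/ pos (- act g (sroot s)).
Proof. by have [/act_neg|/act_pos] := ell_dichotomy g s; auto. Qed.

(** A nontrivial element has a descent and so makes a simple root negative, whereas [g / h] fixes
    all simple roots. *)
Lemma act_faithful g h : (forall x, act g x = act h x) -> g = h.
Proof.
move=> gh; apply/divg1_eq; apply/eqP/negPn/negP => /last_descent[s /act_neg].
have -> : act (g / h) (sroot s) = sroot s by rewrite actM gh actKV.
move=> ns; have := pos_neg_eq0 (pos_sroot s) ns.
by move/ffunP/(_ s)/eqP; rewrite !ffunE eqxx oner_eq0.
Qed.

End Geometric.

Close Scope ring_scope.

(** * Reflections and ascending paths of roots *)

Local Open Scope ring_scope.

Section Roots.
Variables (R : realFieldType) (C : coxeterSystem).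
Local Notation S := (cox_index C).
Variable a : S -> S -> R.
Hypothesis aP : cartan (@cox_m C) a.
Local Notation V := {ffun S -> R^o}.
Local Notation ell := (@cox_length C).
Local Notation gen := (@cox_gen C).
Local Notation sroot := (@sroot R C).
Local Notation coord := (coord a).
Local Notation refl := (refl a).
Local Notation form := (form a).
Local Notation acts := (acts a).
Local Notation act := (act a).
Local Notation adj := (adj a).
Implicit Types (s t r : S) (x y z : V) (u v : word C) (g h : C).

Lemma root_multiple g r s : pos (act g (sroot r)) ->
  (forall q, q != s -> act g (sroot r) q = 0) -> act g (sroot r) = sroot s.
Proof.
set b := act g _ => /posP b0 bs.
have bE : b = (b s : R) *: sroot s.
  apply/ffunP => q; rewrite vecZ srootE; case: eqP => [->|/eqP/bs ->].
    by rewrite mulr1.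
  by rewrite mulr0.
have := form_root aP g r; rewrite -/b bE formZr form_sym // formZr.
rewrite form_sroot coord_sroot (cartan_diag aP) => b2.
have -> : (b s : R) = 1 by have := b0 s; nra.
by rewrite scale1r.
Qed.

(** [refl s] changes only the coordinate at [s], so a positive root that it makes negative is
    supported at [s]. *)
Lemma root_refl_neg g r s : pos (act g (sroot r)) ->
  pos (- refl s (act g (sroot r))) -> act g (sroot r) = sroot s.
Proof.
move=> b0 /posP sb; apply: root_multiple => // q qs.
have := sb q; have /posP/(_ q) := b0; rewrite vecN refl_neq // => h1 h2.
by apply/eqP; rewrite eq_le h1 andbT; lra.
Qed.

Lemma root_refl_pos g r s : pos (act g (sroot r)) -> act g (sroot r) != sroot s ->
  pos (refl s (act g (sroot r))).
Proof.
move=> b0 /eqP bs; have := root_sign aP (gen s * g)%g r; rewrite actM // act_gen //.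
by case=> // /(root_refl_neg b0).
Qed.

(** The reflection t in [b] adds a positive multiple of [b] to the simple root of [s], so ts is
    longer than t, and so is its inverse st. That image is a positive root other than the simple
    one, so it stays positive under s, and the second factor s lengthens st again. *)
Lemma ell_reflection_up g r s : pos (act g (sroot r)) -> coord s (act g (sroot r)) < 0 ->
  ell (gen s * reflection g r * gen s)%g = (ell (reflection g r)).+2.
Proof.
set b := act g _ => b0 sb; set t := reflection g r.
have tE : act t (sroot s) = sroot s + (- coord s b) *: b.
  by rewrite reflectionE // form_sym // form_sroot scaleNr.
have t0 : pos (act t (sroot s)) by rewrite tE posD ?pos_sroot // posZ // oppr_ge0 ltW.
have up1 : ell (t * gen s)%g = (ell t).+1 by apply: ell_up; rewrite -(act_posE aP).
have stE : (t * gen s)^-1%g = (gen s * t)%g by rewrite invgM gen_inv reflectionV.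
rewrite -up1 -(ellV (t * gen s)) stE; apply: ell_up.
rewrite -(act_posE aP) // actM // act_gen //.
apply: root_refl_pos => //; rewrite tE; apply/eqP => /(canRL (addKr _)).
rewrite addNr => /eqP; rewrite scaler_eq0 oppr_eq0 (lt_eqF sb) /=.
by rewrite (negPf (root_neq0 aP g r)).
Qed.

(** Paths are read from the right, as in [acts], so the most recent step is the head of the word. *)
Fixpoint ascending r u : bool :=
  if u is s :: u' then (coord s (acts u' (sroot r)) < 0) && ascending r u' else true.

Lemma ascending_pos r u : ascending r u -> pos (acts u (sroot r)).
Proof.
elim: u => [|s u IHu] /=; first by rewrite pos_sroot.
case/andP=> su /IHu u0; rewrite /refl -scaleNr posD // posZ ?pos_sroot //.
by rewrite oppr_ge0 ltW.
Qed.

Lemma word_palindrome u r : word_elt (u ++ r :: rev u) = reflection (word_elt u) r.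
Proof. by rewrite word_cat word_cons word_rev /reflection mulgA. Qed.

Lemma ascending_ell r u : ascending r u -> ell (reflection (word_elt u) r) = (size u).*2.+1.
Proof.
elim: u => [|s u IHu] /=; first by rewrite /reflection word_nil mul1g invg1 mulg1 ell_gen.
case/andP=> su ru; rewrite word_cons -reflection_conj ell_reflection_up ?act_word //.
  by rewrite IHu.
exact: ascending_pos.
Qed.

Lemma ascending_Pal r u : ascending r u -> Pal C (u ++ r :: rev u).
Proof.
move=> ru; apply/andP; split; last by rewrite /palindromic rev_cat rev_cons revK cat_rcons.
by rewrite /reduced word_palindrome ascending_ell // size_cat /= size_rev addnS addnn.
Qed.

(** Otherwise the norm 2 of the root would be a sum of nonpositive terms. *)
Lemma root_has_pos_coord g r : pos (act g (sroot r)) -> exists s, 0 < coord s (act g (sroot r)).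
Proof.
move=> /posP b0; apply/existsP; apply: contraT; rewrite negb_exists => /forallP bs.
have := form_root aP g r; suff: form (act g (sroot r)) (act g (sroot r)) <= 0 by lra.
by apply: sumr_le0 => s _; rewrite mulr_ge0_le0 // leNgt.
Qed.

(** Descent on the length of the reflection: a positive root pairs positively with some simple root;
    either it equals that root, or reflecting shortens its reflection by two. *)
Lemma ascending_exists g r : pos (act g (sroot r)) ->
  exists u r', ascending r' u /\ acts u (sroot r') = act g (sroot r).
Proof.
have [n] := ubnP (ell (reflection g r)); elim: n g => // n IHn g gn b0.
have [s sb] := root_has_pos_coord b0.
have [bs|bs] := eqVneq (act g (sroot r)) (sroot s); first by exists [::], s.
have b0' := root_refl_pos b0 bs.
have sgE : act (gen s * g)%g (sroot r) = refl s (act g (sroot r)) by rewrite actM // act_gen.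
have sb' : coord s (act (gen s * g)%g (sroot r)) < 0 by rewrite sgE coord_refl_same // oppr_lt0.
have := ell_reflection_up _ sb'; rewrite sgE reflection_conj gen_mulKV => /(_ b0') up.
have [||u [r' [ru uE]]] := IHn (gen s * g)%g; rewrite ?sgE //; first by lia.
by exists (s :: u), r'; rewrite /= ru uE andbT sb' sgE reflK.
Qed.

Lemma reflection_inj g h r s : act g (sroot r) = act h (sroot s) -> reflection g r = reflection h s.
Proof. by move=> gh; apply: (act_faithful aP) => x; rewrite !reflectionE // gh. Qed.

(** The size of a path is the depth of its end root: it is read off from the length of the
    reflection, which the root determines. *)
Lemma ascending_size r r' u u' : ascending r u -> ascending r' u' ->
  acts u (sroot r) = acts u' (sroot r') -> size u = size u'.
Proof.
move=> ru ru'; rewrite -!act_word // => /reflection_inj E.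
by apply: double_inj; apply: succn_inj; rewrite -(ascending_ell ru) E ascending_ell.
Qed.

Lemma coord_support s x : coord s x != 0 ->
  exists2 t, a s t != 0 & x t != 0.
Proof.
move=> sx; suff /existsP[t /andP[]] : [exists t, (a s t != 0) && (x t != 0)] by exists t.
apply: contraT; rewrite negb_exists => /forallP x0; case/eqP: sx.
apply: big1 => t _; move: (x0 t); rewrite negb_and !negbK => /orP[/eqP->|/eqP->].
  by rewrite mul0r.
by rewrite mulr0.
Qed.

Lemma acts_support u r q : acts u (sroot r) q != 0 -> connect adj r q.
Proof.
elim: u q => [|s u IHu] q /=.
  by rewrite srootE; case: (eqVneq q r) => [->|_]; rewrite ?connect0 ?eqxx.
have [->|qs] := eqVneq q s; last by rewrite refl_neq //; apply: IHu.
have [sx|sx] := eqVneq (coord s (acts u (sroot r))) 0.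
  by rewrite refl_eq sx subr0; apply: IHu.
have [t ast xt] := coord_support sx; move=> _.
have rt := IHu _ xt; have [<-|ts] := eqVneq t s; first by [].
by apply: connect_trans rt (connect1 _); rewrite (adj_sym aP) /adj eq_sym ts.
Qed.

Lemma act_support g r q : act g (sroot r) q != 0 -> connect adj r q.
Proof. exact: acts_support. Qed.

Lemma coord_connect g r s : coord s (act g (sroot r)) != 0 -> connect adj r s.
Proof.
move=> /coord_support[t ast /act_support rt].
have [<-|ts] := eqVneq t s; first by [].
by apply: connect_trans rt (connect1 _); rewrite (adj_sym aP) /adj eq_sym ts.
Qed.

(** A local form of finiteness: it spreads along edges ([fin_orbit_adj]), and if it holds at all
    vertices the group is finite ([fin_orbits_finite]). *)
Definition fin_orbit r : Prop := exists l : seq V, forall g, act g (sroot r) \in l.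

Lemma fin_orbit_act r s g : act g (sroot r) = sroot s -> fin_orbit s -> fin_orbit r.
Proof.
move=> gs [l ls]; exists l => h.
by rewrite -(actK aP g (sroot r)) gs -actM.
Qed.

(** Reflecting the simple root of [r] in [s] moves it by a nonzero multiple of the simple root of
    [s], so the orbit of the latter consists of scaled differences of roots in the former orbit. *)
Lemma fin_orbit_adj r s : adj r s -> fin_orbit r -> fin_orbit s.
Proof.
move=> rs [l lr]; have c0 := adj_lt0 aP rs.
exists [seq (- a r s)^-1 *: (x - y) | x <- l, y <- l] => g.
have -> : act g (sroot s) = (- a r s)^-1 *: (act (g * gen s)%g (sroot r) - act g (sroot r)).
  rewrite actM // -actN -actD act_gen // /refl coord_sroot.
  rewrite addrC addrA addNr add0r -scaleNr actZ scalerA (cartan_sym aP s r) mulVf ?scale1r //.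
  by rewrite oppr_eq0 lt_eqF.
exact: (allpairs_f (fun x y => (- a r s)^-1 *: (x - y))).
Qed.

(** By [root_refl_neg] each letter makes at most one further positive root negative. *)
Lemma inversions_finite u : exists l : seq V, forall g r,
  pos (act g (sroot r)) -> pos (- acts u (act g (sroot r))) -> act g (sroot r) \in l.
Proof.
elim: u => [|s u [l lP]].
  exists [::] => g r g0 /(pos_neg_eq0 g0)/eqP.
  by rewrite (negPf (root_neq0 aP g r)).
exists (act (word_elt (rev u)) (sroot s) :: l) => g r g0 sg0.
rewrite in_cons; have := root_sign aP (word_elt u * g)%g r.
rewrite actM // act_word // => -[u0|/(lP _ _ g0)->]; last by rewrite orbT.
have := @root_refl_neg (word_elt u * g)%g r s; rewrite actM // act_word //.
by move=> /(_ u0 sg0) <-; rewrite -(act_word aP u) word_rev actK // eqxx.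
Qed.

Lemma iter_refl_finite (l : seq V) n : exists l' : seq V, forall u x,
  x \in l -> (size u <= n)%N -> acts u x \in l'.
Proof.
elim: n => [|n [l' lP]]; first by exists l => -[].
exists (l' ++ [seq refl s x | s <- enum S, x <- l']) => -[|s u] x xl sn; rewrite mem_cat.
  by rewrite lP.
by apply/orP; right; apply: allpairs_f; rewrite ?mem_enum // lP.
Qed.

Lemma connect_boundary (P : pred S) r s : connect adj r s -> P r -> ~~ P s ->
  exists p q, [/\ adj p q, P p, ~~ P q & connect adj r q].
Proof.
case/connectP=> p; elim: p r => [|t p IHp] r /= => [_ -> ->//|/andP[rt tp] ls Pr Ps].
have [Pt|Pt] := boolP (P t); last by exists r, t; rewrite connect1.
have [p' [q [pq Pp Pq tq]]] := IHp t tp ls Pt Ps.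
by exists p', q; split=> //; apply: connect_trans (connect1 rt) tq.
Qed.

(* A dominant root b makes the orbit finite: the reflection in b inverts every
   positive root g with form b g > 0, and any positive root of the component is
   raised to such a g by enlarging its support at most #|S| times. *)
Lemma dominant_fin_orbit g r : pos (act g (sroot r)) ->
  (forall s, 0 <= coord s (act g (sroot r))) -> fin_orbit r.
Proof.
set b := act g (sroot r) => b0 dom.
have [l lP] := inversions_finite (word_of (reflection g r)).
have form_ge0 x : pos x -> 0 <= form b x.
  by move=> /posP x0; rewrite form_sym //; apply: sumr_ge0 => s _; rewrite mulr_ge0.
(* The reflection in [b] negates the pairing with [b], which dominance makes nonnegative on positive
   vectors; so the image must be negative. *)
have inl h s : pos (act h (sroot s)) -> 0 < form b (act h (sroot s)) -> act h (sroot s) \in l.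
  move=> h0 bh; apply: lP => //.
  rewrite -[X in pos (- X)]/(act (reflection g r) (act h (sroot s))).
  rewrite -actM //; case: (root_sign aP (reflection g r * h)%g s) => // /form_ge0.
  rewrite actM // reflectionE // -/b -scaleNr formDr formZr form_root // => p0.
  by exfalso; lra.
have [q bq] := root_has_pos_coord b0.
have [l' l'P] := iter_refl_finite l #|S|.
have lift h : pos (act h (sroot r)) -> exists u,
    [/\ (size u <= #|[set s | act h (sroot r) s == 0%R]|)%N,
    pos (act (word_elt u * h)%g (sroot r)) & 0 < form b (act (word_elt u * h)%g (sroot r))].
  have [n] := ubnP #|[set s | act h (sroot r) s == 0%R]|; elim: n h => // n IHn h hn h0.
  have := form_ge0 _ h0; rewrite le_eqVlt => /orP[/eqP bh|bh]; last first.
    by exists [::]; rewrite word_nil mul1g.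
  (* A vanishing sum of nonnegative terms vanishes term by term. *)
  have supp0 s : 0 < coord s b -> act h (sroot r) s = 0.
    move=> sb; apply/eqP; move/posP: (h0) => h0'; rewrite eq_le h0' andbT leNgt.
    apply/negP => hs; move/eqP: bh; rewrite form_sym // eq_sym psumr_eq0 => [|t _].
      by move/allP/(_ s (mem_index_enum s)); rewrite mulf_eq0 !gt_eqF.
    by rewrite mulr_ge0.
  have [s0 hs0] : exists s0, act h (sroot r) s0 != 0.
    apply/existsP; apply: contraT; rewrite negb_exists => /forallP z.
    case/eqP: (root_neq0 aP h r); apply/ffunP => s; rewrite [RHS]ffunE.
    by apply/eqP; rewrite -[_ == _]negbK.
  have s0q : connect adj s0 q.
    apply: (connect_trans (y := r)); first by rewrite (adj_connect_sym aP) (act_support hs0).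
    by apply: (@coord_connect g); rewrite gt_eqF.
  (* The support misses [q], so some edge leaves it; reflecting at the outer end [t] enlarges the
     support. *)
  have [|p [t [pt hp ht s0t]]] := @connect_boundary (fun s => act h (sroot r) s != 0) _ _ s0q hs0.
    by rewrite negbK supp0.
  move: ht; rewrite negbK => /eqP ht.
  have tneg : coord t (act h (sroot r)) < 0.
    rewrite /coord (bigD1 p) //=.
    have h1 : a t p * (act h (sroot r) p : R) < 0.
      rewrite nmulr_rlt0 ?(adj_lt0 aP) // 1?(adj_sym aP) //.
      by move/posP/(_ p): h0; rewrite le_eqVlt eq_sym (negPf hp).
    have h2 : \sum_(i | i != p) a t i * (act h (sroot r) i : R) <= 0.
      apply: sumr_le0 => i ip; have [->|it] := eqVneq i t; first by rewrite ht mulr0.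
      by rewrite mulr_le0_ge0 //; [rewrite (cartan_le0 aP) // eq_sym | move/posP: h0].
    by rewrite -[ltRHS]addr0 ltr_leD.
  have th0 : pos (act (gen t * h)%g (sroot r)).
    rewrite actM // act_gen //; apply: root_refl_pos => //; apply/eqP => E.
    by move: tneg; rewrite E coord_sroot (cartan_diag aP); lra.
  have lt : (#|[set s | act (gen t * h)%g (sroot r) s == 0%R]| <
      #|[set s | act h (sroot r) s == 0%R]|)%N.
    apply: proper_card; apply/properP; split.
      apply/subsetP => s; rewrite !inE actM // act_gen //.
      have [->|st] := eqVneq s t; first by rewrite ht.
      by rewrite refl_neq.
    exists t; rewrite !inE ?ht // actM // act_gen // refl_eq ht sub0r oppr_eq0.
    by rewrite lt_eqF.
  have [|u [us u0 bu]] := IHn _ _ th0; first exact: leq_trans lt _.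
  exists (rcons u t); rewrite word_rcons -mulgA; split=> //.
  by rewrite size_rcons (leq_ltn_trans us).
exists (l' ++ map -%R l') => h.
have inl' h' : pos (act h' (sroot r)) -> act h' (sroot r) \in l'.
  move=> /lift[u [us u0 bu]].
  have -> : act h' (sroot r) = acts (rev u) (act (word_elt u * h')%g (sroot r)).
    by rewrite actM // -(act_word aP) word_rev actK.
  apply: l'P; first exact: inl.
  by rewrite size_rev (leq_trans us) // max_card.
rewrite mem_cat; have [h0|h0] := root_sign aP h r; first by rewrite inl'.
apply/orP; right; apply/mapP; exists (- act h (sroot r)); rewrite ?opprK //.
have hE : - act h (sroot r) = act (h * gen r)%g (sroot r).
  by rewrite actM // act_gen // refl_sroot // actN.
by rewrite hE inl' // -hE.
Qed.

End Roots.

Close Scope ring_scope.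

(** * A numbers game *)

Local Open Scope ring_scope.

Lemma recurrent_value (S : finType) (s : nat -> S) :
  exists t, forall n, exists2 i, (n <= i)%N & s i = t.
Proof.
apply: contrapT => H.
have {}H t : exists n, forall i, (n <= i)%N -> s i != t.
  apply: contrapT => Ht; apply: H; exists t => n; apply: contrapT => Hn; apply: Ht.
  by exists n => i ni; apply/eqP => st; apply: Hn; exists i.
have [f fP] := choice H.
have := fP (s (\max_t f t)) (\max_t f t) (leq_bigmax _).
by rewrite eqxx.
Qed.

(* The state [v i t] is the pairing of the i-th root of an ascending path with
   the simple root [t]; firing [s i] turns it into the state of the next root. *)
Section NumbersGame.
Variables (R : realFieldType) (S : finType) (m : S -> S -> option nat) (a : S -> S -> R).
Hypothesis aP : cartan m a.
Local Notation adj := (adj a).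

(** An isolated vertex counts as a leaf too. *)
Definition leaf t : bool := [forall p, forall q, adj t p ==> (adj t q ==> (p == q))].

Lemma leafP t : reflect (forall p q, adj t p -> adj t q -> p = q) (leaf t).
Proof.
apply: (iffP forallP) => [H p q tp tq|H p].
  by move/forallP/(_ q): (H p); rewrite tp tq => /eqP.
by apply/forallP => q; apply/implyP => tp; apply/implyP => tq; apply/eqP/H.
Qed.

Lemma nonleaf_other t r : ~~ leaf t -> exists2 e, adj t e & e != r.
Proof.
case/forallPn => p /forallPn[q]; rewrite !negb_imply => /and3P[tp tq pq].
by have [pr|] := eqVneq p r; [exists q; rewrite // -pr eq_sym | exists p].
Qed.

Variables (v : nat -> S -> R) (s : nat -> S) (o : S) (N : nat).
Hypothesis v0 : forall t, v 0%N t = a t o.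
Hypothesis vS : forall i t, v i.+1 t = v i t - a t (s i) * v i (s i).
Hypothesis v_lt0 : forall i, v i (s i) < 0.
Hypothesis s_connect : forall i, connect adj o (s i).
Hypothesis o_nonleaf : ~~ leaf o.
Hypothesis neg_uniq : forall i t, (N <= i)%N -> v i t < 0 -> t = s i.
Hypothesis pos_uniq : forall i t, (N <= i)%N -> 0 < v i.+1 t -> t = s i.

Let vs i : v i.+1 (s i) = - v i (s i).
Proof. by rewrite vS (cartan_diag aP); ring. Qed.

Let s_neq i : s i.+1 != s i.
Proof.
apply/eqP => E; have := v_lt0 i.+1; rewrite E vs; have := v_lt0 i; lra.
Qed.

Let v_eq0 i t : (N <= i)%N -> t != s i -> t != s i.+1 -> v i.+1 t = 0.
Proof.
move=> Ni t1 t2; apply/eqP; rewrite eq_le !leNgt; apply/andP; split; apply/negP.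
  by move/(pos_uniq Ni)/eqP; rewrite (negPf t1).
by move/(neg_uniq (leqW Ni))/eqP; rewrite (negPf t2).
Qed.

(** Such a neighbour has value zero, so firing [s i.+1] makes it negative, and it must be fired
    next. *)
Let nbr_next i t : (N <= i)%N -> adj t (s i.+1) -> t != s i -> t = s i.+2.
Proof.
move=> Ni ts ti; apply: neg_uniq; first by lia.
have t1 : t != s i.+1 by case/andP: ts.
rewrite vS v_eq0 // sub0r oppr_lt0 nmulr_rgt0 ?(adj_lt0 aP ts) //.
Qed.

(** Were they not joined, [s i.+1] would already be negative at time [i], beside [s i]. *)
Let adj_next i : (N <= i)%N -> adj (s i.+1) (s i).
Proof.
move=> Ni; rewrite /adj s_neq /=; apply/eqP => a0.
have := v_lt0 i.+1; rewrite vS a0 mul0r subr0 => /(neg_uniq Ni)/eqP.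
by rewrite (negPf (s_neq i)).
Qed.

Let adj_prev i : (N <= i)%N -> adj (s i) (s i.+1).
Proof. by rewrite (adj_sym aP); apply: adj_next. Qed.

Let recurrent t := forall n, exists2 i, (n <= i)%N & s i = t.

(** A neighbour of a site fired late was fired just before it or is fired just after it. *)
Let recurrent_adj t q : recurrent t -> adj t q -> recurrent q.
Proof.
move=> rt tq n; have [[|i] ni st] := rt (maxn n N).+1 => //.
have Ni : (N <= i)%N by lia.
have [E|qi] := eqVneq q (s i); first by exists i => //; lia.
exists i.+2; first by lia.
by apply/esym/nbr_next; rewrite // (adj_sym aP) st.
Qed.

Let recurrent_connect t q : connect adj t q -> recurrent t -> recurrent q.
Proof.
case/connectP=> p; elim: p t => [|t' p IHp] t /= => [_ -> //|/andP[tt' tp] ls rt].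
exact: (IHp t' tp ls (recurrent_adj rt tt')).
Qed.

Let recurrent_o t : connect adj o t -> recurrent t.
Proof.
move=> ot; have [q rq] := recurrent_value s; have [i _ si] := rq 0%N.
apply: recurrent_connect rq; rewrite -si.
by apply: connect_trans ot; rewrite (adj_connect_sym aP).
Qed.

Let connect_o t q : connect adj o t -> adj t q -> connect adj o q.
Proof. by move=> ot tq; apply: connect_trans ot (connect1 tq). Qed.

(** If the path turned back here, [nbr_next] would leave the site with a single neighbour. *)
Let nonleaf_turn i : (N < i)%N -> ~~ leaf (s i) -> s i.+1 != s i.-1.
Proof.
case: i => // i Ni; apply: contra => /eqP E; apply/leafP => p q sp sq.
have only r : adj (s i.+1) r -> r = s i.
  move=> sr; apply/eqP; apply: contraT => ri.
  have Ni' : (N <= i)%N by [].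
  have sr' : adj r (s i.+1) by rewrite (adj_sym aP).
  by move: (ri); rewrite (nbr_next Ni' sr' ri) E eqxx.
by rewrite (only p) // (only q).
Qed.

Let leaf_turn i : (N < i)%N -> leaf (s i) -> s i.+1 = s i.-1.
Proof. by case: i => // i Ni /leafP; apply; [apply/adj_prev/leqW | apply: adj_next]. Qed.

(** Two adjacent leaves would be the whole component, which contains the non-leaf [o]. *)
Let not_two_leaves p q : connect adj o p -> adj p q -> leaf p -> ~~ leaf q.
Proof.
move=> op pq /leafP lp; apply/negP => /leafP lq.
have closed r t : (r == p) || (r == q) -> adj r t -> (t == p) || (t == q).
  move=> /orP[]/eqP->.
    by move=> pt; rewrite (lp t q) // eqxx orbT.
  by move=> qt; rewrite (lq t p) ?eqxx // (adj_sym aP).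
have [lo|] := boolP ((o == p) || (o == q)).
  by move: o_nonleaf; case/orP: lo => /eqP->; move/negP; apply; apply/leafP.
have : connect adj p o by rewrite (adj_connect_sym aP).
case/connectP=> w; suff : forall r, (r == p) || (r == q) -> path adj r w ->
    (last r w == p) || (last r w == q).
  by move=> H pw ->; rewrite H ?eqxx.
by elim: w => //= t w IHw r rpq /andP[rt tw]; apply: IHw tw; apply: closed rt.
Qed.

(** The path moves on from [s i.+1] without returning, so the value at [s i] is zero after that
    firing. *)
Let pass_out i : (N < i)%N -> ~~ leaf (s i.+1) ->
  v i.+1 (s i) = a (s i) (s i.+1) * v i.+1 (s i.+1).
Proof.
move=> Ni l; have := @v_eq0 i.+1 (s i); rewrite vS => H.
apply/eqP; rewrite -subr_eq0 H //; first by lia.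
  by rewrite eq_sym s_neq.
by rewrite eq_sym (@nonleaf_turn i.+1) // ltnW.
Qed.

Let pass_in i : (N < i)%N -> ~~ leaf (s i) ->
  v i.+1 (s i.+1) = a (s i.+1) (s i) * v i.+1 (s i).
Proof.
case: i => // i Ni l; rewrite vs vS.
have -> : v i.+1 (s i.+2) = 0 by apply: v_eq0; [ | exact: nonleaf_turn l | exact: s_neq].
by rewrite sub0r mulrN.
Qed.

(** The path bounces off the leaf; comparing the values on the way in and out gives c^2 = 2, as for
    label 4. The component thus looks like an affine diagram of type C, or of type A when it has no
    leaves. *)
Let into_leaf i : (N < i)%N -> ~~ leaf (s i) -> leaf (s i.+1) ->
  a (s i) (s i.+1) ^+ 2 = 2.
Proof.
move=> Ni nl l; have l2 : ~~ leaf (s i.+2) by rewrite (leaf_turn (leqW Ni) l).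
have := pass_out (leqW Ni) l2; rewrite (leaf_turn (leqW Ni) l) /=.
rewrite vs (vS i.+1 (s i)) (pass_in Ni nl).
have := adj_lt0 aP (adj_prev (ltnW Ni)); rewrite (cartan_sym aP (s i.+1)).
set c := a _ _; have := v_lt0 i; rewrite vs; set x := v i _ => x0 c0 H.
have : c * x * (c ^+ 2 - 2) = 0.
  by apply/eqP; rewrite -(subrr (- (c * - x))) {1}H; apply/eqP; ring.
have cx : c * x != 0 by rewrite mulf_neq0 // lt_eqF.
by move/eqP; rewrite mulf_eq0 (negPf cx) subr_eq0 => /eqP.
Qed.

Let inner_step j : (N < j)%N -> ~~ leaf (s j) -> ~~ leaf (s j.+1) ->
  a (s j) (s j.+1) ^+ 2 = 1.
Proof.
move=> Nj l1 l2; have := pass_out Nj l2; rewrite (pass_in Nj l1) (cartan_sym aP (s j.+1)) vs.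
set c := a _ _; set x := v _ _ => H; have x0 : x != 0 by rewrite lt_eqF ?v_lt0.
apply: (mulIf x0); apply: oppr_inj; rewrite mul1r H; ring.
Qed.

(** By recurrence every edge of the component is crossed at a late time, in one direction or the
    other. *)
Let inner_edge t q : connect adj o t -> adj t q -> ~~ leaf t -> ~~ leaf q -> a t q ^+ 2 = 1.
Proof.
move=> ot tq lt lq; have [[|i] Ni si] := recurrent_o ot N.+3 => //.
have [qi|qi] := eqVneq q (s i).
  by rewrite qi -si (cartan_sym aP) inner_step ?si -?qi //; lia.
have qi2 : q = s i.+2 by apply: nbr_next => //; [lia | rewrite si (adj_sym aP)].
by rewrite qi2 -si inner_step ?si -?qi2 //; lia.
Qed.

Let leaf_edge t q : connect adj o t -> adj t q -> leaf t -> a t q ^+ 2 = 2.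
Proof.
move=> ot tq lt; have [[|i] Ni si] := recurrent_o ot N.+3 => //.
have -> : q = s i by move/leafP: lt; apply=> //; rewrite -si adj_next //; lia.
rewrite (cartan_sym aP) -si; apply: into_leaf; [lia | | by rewrite si].
apply: (not_two_leaves ot) lt; rewrite -si adj_next //; lia.
Qed.

Let adj_uniq t p q r : connect adj o t -> adj t p -> adj t q -> adj t r ->
  p != q -> r != q -> r = p.
Proof.
move=> ot tp tq tr pq rq; have [[|i] Ni si] := recurrent_o ot N.+3 => //.
have nb z : adj t z -> z = s i \/ z = s i.+2.
  move=> tz; have [|zi] := eqVneq z (s i); first by left.
  by right; apply: nbr_next => //; [lia | rewrite si (adj_sym aP)].
move: pq rq; case: (nb p tp) => ->; case: (nb q tq) => ->; case: (nb r tr) => ->;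
  by rewrite ?eqxx.
Qed.

(* The shape of a deep state: it is preserved when the path is run backwards. *)
Let pattern (w : S -> R) p q := [/\ [/\ connect adj o p, adj p q, 0 < w p & w q < 0],
  forall t, t != p -> t != q -> w t = 0,
  ~~ leaf p -> w q = a q p * w p & leaf p -> w p = a p q * w q].

(** Undoing the firing of [p]. At an inner [p] the entry at [q] cancels and the other neighbour
    becomes positive; at a leaf the entry at [q] changes sign, because the squared edge value is
    2. *)
Let pattern_back (w w' : S -> R) p q : (forall t, w' t = w t - a t p * w p) ->
  pattern w' p q -> exists e, pattern w e p.
Proof.
move=> ww' [[op pq p0 q0] other nl l].
have wp : w p = - w' p by rewrite ww' (cartan_diag aP); ring.
have wE t : w t = w' t - a t p * w' p by rewrite (ww' t) wp; ring.
have qp : q != p by case/andP: pq => pq _; rewrite eq_sym.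
have [lp|lp] := boolP (leaf p); last first.
  have [e pe eq] := nonleaf_other q lp.
  have ep : e != p by case/andP: pe => pe _; rewrite eq_sym.
  have we : w e = - (a e p * w' p) by rewrite wE other // sub0r.
  have oe : connect adj o e := connect_o op pe.
  have pe' : adj e p by rewrite (adj_sym aP).
  exists e; split.
  - split=> //; last by rewrite wp oppr_lt0.
    by rewrite we oppr_gt0 nmulr_rlt0 // (adj_lt0 aP).
  - move=> t te tp; have [->|tq] := eqVneq t q; first by rewrite wE (nl lp) subrr.
    rewrite wE other // sub0r; have [pt|] := boolP (adj p t).
      by case/eqP: te; apply: (adj_uniq op pe pq pt).
    by rewrite /adj eq_sym tp negbK (cartan_sym aP) => /eqP->; rewrite mul0r oppr0.
  - move=> le; rewrite wp we (cartan_sym aP p e) mulrN mulrA -expr2.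
    by rewrite inner_edge // mul1r.
  by move=> _; rewrite we wp mulrN.
have lq := not_two_leaves op pq lp.
have a2 := leaf_edge op pq lp.
have wq : w q = - w' q.
  rewrite wE (l lp) (cartan_sym aP q p) mulrA -expr2 a2; ring.
exists q; split.
- split; rewrite ?(connect_o op pq) // 1?(adj_sym aP) //.
    by rewrite wq oppr_gt0.
  by rewrite wp oppr_lt0.
- move=> t tq tp; rewrite wE other // sub0r; have [pt|] := boolP (adj p t).
    by case/eqP: tq; move/leafP: lp; apply.
  by rewrite /adj eq_sym tp negbK (cartan_sym aP) => /eqP->; rewrite mul0r oppr0.
- by move=> _; rewrite wp wq mulrN (l lp).
by rewrite (negPf lq).
Qed.

Lemma numbers_game_absurd : False.
Proof.
pose M := N.+2.
have patM : pattern (v M.+1) (s M) (s M.+1).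
  split; first split=> //.
  - by apply: adj_prev; rewrite /M; lia.
  - by rewrite vs oppr_gt0.
  - by move=> t; apply: v_eq0; rewrite /M; lia.
  - by apply: pass_in; rewrite /M; lia.
  move=> l; apply: pass_out; first by rewrite /M; lia.
  by apply: (not_two_leaves _ _ l) => //; apply: adj_prev; rewrite /M; lia.
have back i : (exists e, pattern (v i.+1) e (s i.+1)) -> exists e, pattern (v i) e (s i).
  case=> e pat; apply: pattern_back (vS i) _.
  suff -> : s i = e by exact: pat.
  case: pat => [[_ _ _ q0] other _ _]; have vi : 0 < v i.+1 (s i) by rewrite vs oppr_gt0.
  apply/eqP; apply: contraT => se.
  have si : s i != s i.+1 by rewrite eq_sym.
  by rewrite (other _ se si) ltxx in vi.
have [e [[_ _ e0 _] other _ _]] : exists e, pattern (v 0%N) e (s 0%N).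
  have : exists e, pattern (v M.+1) e (s M.+1) by exists (s M).
  by elim: M.+1 => // i IHi /back/IHi.
have neg t : adj o t -> t = s 0%N.
  move=> ot; have vt : v 0%N t < 0 by rewrite v0 (adj_lt0 aP) // (adj_sym aP).
  apply/eqP; apply: contraT => ts; have te : t != e.
    by apply: contraTneq vt => ->; rewrite -leNgt ltW.
  by rewrite other ?ltxx in vt.
by move/leafP: o_nonleaf; apply => p q /neg-> /neg->.
Qed.

End NumbersGame.

Close Scope ring_scope.

(** * Bounded numbers of ascending paths *)

Local Open Scope ring_scope.

Lemma eventually_constant (f : nat -> nat) B :
  (forall n, f n <= f n.+1)%N -> (forall n, f n <= B)%N ->
  exists N, forall n, (N <= n)%N -> f n.+1 = f n.
Proof.
move=> fS fB; apply: contrapT => H.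
have unbounded k : exists n, (k <= f n)%N.
  elim: k => [|k [n kn]]; first by exists 0%N.
  apply: contrapT => H'; apply: H; exists n => i ni.
  have fi : (f n <= f i)%N by apply: (homo_leq (@leqnn) leq_trans fS).
  have := fS i; case: (ltnP k (f i.+1)) => [lt|]; last by lia.
  by case: H'; exists i.+1.
by have [n] := unbounded B.+1; rewrite ltnNge fB.
Qed.

Section Paths.
Variables (R : realFieldType) (C : coxeterSystem).
Local Notation S := (cox_index C).
Variable a : S -> S -> R.
Hypothesis aP : cartan (@cox_m C) a.
Local Notation V := {ffun S -> R^o}.
Local Notation sroot := (@sroot R C).
Local Notation coord := (coord a).
Local Notation refl := (refl a).
Local Notation acts := (acts a).
Local Notation act := (act a).
Local Notation adj := (adj a).
Local Notation ascending := (ascending a).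
Local Notation fin_orbit := (fin_orbit a).
Implicit Types (s t r : S) (x y z : V) (u v : word C).

Lemma Pal_prefix_inj (M : dfa S) r u u' :
  (forall w, Pal C w = dfa_accepts M w) -> size u = size u' ->
  Pal C (u' ++ r :: rev u') ->
  foldl (@dfa_trans S M) (dfa_start M) u = foldl (@dfa_trans S M) (dfa_start M) u' ->
  u = u'.
Proof.
move=> MP su pal E; have : Pal C (u ++ r :: rev u').
  by rewrite MP /dfa_accepts foldl_cat E -foldl_cat -/(dfa_accepts M _) -MP.
case/andP=> _; rewrite /palindromic rev_cat rev_cons revK cat_rcons eqseq_cat //.
by case/andP=> /eqP.
Qed.

Definition path_set n : {set n.-tuple S * S} := [set p : n.-tuple S * S | ascending p.2 p.1].

Lemma path_set_bound : regular (Pal C) -> exists B, forall n, (#|path_set n| <= B)%N.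
Proof.
case=> M MP; exists #|{: dfa_state M * S}| => n.
(* A path of given length is determined by the state its word leads to and by its centre. *)
pose f (p : n.-tuple S * S) := (foldl (@dfa_trans S M) (dfa_start M) p.1, p.2).
rewrite -(@card_in_imset _ _ f) ?max_card // => -[u r] [u' r'].
rewrite !inE /= => ru ru' [E rr'].
rewrite -rr' in ru' *; congr (_, _); apply/val_inj; apply: (Pal_prefix_inj MP) E.
  by rewrite !size_tuple.
exact: (ascending_Pal aP ru').
Qed.

Definition inf_path r u : bool := ascending r u && `[< ~ fin_orbit r >].

(** Apart from the default [r], the choice depends only on the root [x], so infinite paths with a
    common end root are prolonged by the same letter. *)
Definition pick_ascent r x : S := odflt r [pick s | coord s x < 0].

Lemma pick_ascent_dflt r r' x : (exists s, coord s x < 0) -> pick_ascent r x = pick_ascent r' x.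
Proof. by case=> s sx; rewrite /pick_ascent; case: pickP => // /(_ s); rewrite sx. Qed.

Lemma inf_path_ascent r u : inf_path r u -> exists s, coord s (acts u (sroot r)) < 0.
Proof.
case/andP=> ru /asboolP inf; apply: contrapT => H; apply: inf.
have u0 := ascending_pos ru; rewrite -(act_word aP) in u0 H.
apply: (dominant_fin_orbit aP u0) => s; rewrite leNgt; apply/negP => su.
by apply: H; exists s.
Qed.

Lemma pick_ascentP r u : inf_path r u ->
  coord (pick_ascent r (acts u (sroot r))) (acts u (sroot r)) < 0.
Proof.
by move/inf_path_ascent => [s su]; rewrite /pick_ascent; case: pickP => // /(_ s); rewrite su.
Qed.

Lemma inf_path_child r u : inf_path r u -> inf_path r (pick_ascent r (acts u (sroot r)) :: u).
Proof. by move=> ru; rewrite /inf_path /= pick_ascentP //; apply: ru. Qed.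

Definition child n (p : n.-tuple S * S) : n.+1.-tuple S * S :=
  ([tuple of pick_ascent p.2 (acts p.1 (sroot p.2)) :: p.1], p.2).

Lemma child_inj n : injective (@child n).
Proof.
move=> [u r] [u' r'] [_ uu' rr'].
by rewrite rr'; congr (_, _); apply: val_inj.
Qed.

(** Diagonal pairs detect a second ascent from a root; the other pairs detect two last letters
    leading to the same root, that is, a second descent. *)
Definition path_pairs n : {set (n.-tuple S * S) * (n.-tuple S * S)} :=
  [set pp : (n.-tuple S * S) * (n.-tuple S * S) |
    [&& inf_path pp.1.2 pp.1.1, inf_path pp.2.2 pp.2.1 &
    acts pp.1.1 (sroot pp.1.2) == acts pp.2.1 (sroot pp.2.2)]].

Definition child2 n (pp : (n.-tuple S * S) * (n.-tuple S * S)) := (child pp.1, child pp.2).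

Lemma child2_inj n : injective (@child2 n).
Proof.
move=> [p q] [p' q'] E; congr (_, _); apply: child_inj.
  exact: (congr1 fst E).
exact: (congr1 snd E).
Qed.

Lemma child2_path_pairs n : @child2 n @: path_pairs n \subset path_pairs n.+1.
Proof.
apply/subsetP => _ /imsetP[[[u r] [u' r']] + ->]; rewrite !inE /= => /and3P[ru ru' /eqP E].
rewrite !inf_path_child //= -E (pick_ascent_dflt r' r) ?eqxx //.
exact: (inf_path_ascent ru).
Qed.

(** [child2] embeds each set into the next and the sizes are bounded by [B * B], so it is eventually
    onto. *)
Lemma path_pairs_stable : regular (Pal C) -> exists N, forall n, (N <= n)%N ->
  path_pairs n.+1 = @child2 n @: path_pairs n.
Proof.
move=> /path_set_bound[B BP].
have [||N NP] := @eventually_constant (fun n => #|path_pairs n|) (B * B).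
- by move=> n; rewrite -(card_imset _ (@child2_inj n)) subset_leq_card ?child2_path_pairs.
- move=> n; rewrite (leq_trans _ (leq_mul (BP n) (BP n))) // -cardsX subset_leq_card //.
  by apply/subsetP => -[p q]; rewrite !inE => /and3P[/andP[-> _] /andP[-> _]].
exists N => n Nn; apply/esym/eqP; rewrite eqEcard child2_path_pairs.
by have /= -> := NP n Nn; rewrite (card_imset _ (@child2_inj n)) leqnn.
Qed.

Lemma deep_paths : regular (Pal C) -> exists N, forall u r, (N <= size u)%N -> inf_path r u ->
  (forall s t, coord s (acts u (sroot r)) < 0 -> coord t (acts u (sroot r)) < 0 -> s = t) /\
  (forall s t, coord s (acts u (sroot r)) < 0 -> 0 < coord t (acts (s :: u) (sroot r)) -> t = s).
Proof.
case/path_pairs_stable=> N NP; exists N => u r Nu ru.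
(* By stability the pair prolongs a shorter pair with a common end root, so both last letters are
   the same pick. *)
have common s u' r' s' : inf_path r (s :: u) -> inf_path r' (s' :: u') -> size u' = size u ->
    acts (s :: u) (sroot r) = acts (s' :: u') (sroot r') ->
    s = s' /\ s = pick_ascent r (acts u (sroot r)).
  move=> su su' sz E.
  have [u1 u1E] : exists u1 : (size u).-tuple S, val u1 = u by exists (in_tuple u).
  have [u2 u2E] : exists u2 : (size u).-tuple S, val u2 = u'.
    by exists (Tuple (introT eqP sz)).
  have : (([tuple of s :: u1], r), ([tuple of s' :: u2], r')) \in path_pairs (size u).+1.
    by rewrite inE /= u1E u2E su su' /=; apply/eqP; exact: E.
  rewrite NP // => /imsetP[[[w1 q1] [w2 q2]]]; rewrite inE /= => /and3P[/= w1q w2q /eqP E'].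
  case=> /= s1 uw1 rq1 s2 uw2 rq2.
  rewrite s1 s2 -E' rq1; split; first exact/pick_ascent_dflt/(inf_path_ascent w1q).
  by rewrite -uw1 u1E.
have inf_cons s : coord s (acts u (sroot r)) < 0 -> inf_path r (s :: u).
  by move=> su; rewrite /inf_path /= su.
split=> [s t su tu|s t su tsu].
  have [_ ->] := common s u r s (inf_cons s su) (inf_cons s su) erefl erefl.
  by have [_ ->] := common t u r t (inf_cons t tu) (inf_cons t tu) erefl erefl.
have ru' := inf_cons s su; have [asc inf] := andP ru'.
have x0 := ascending_pos asc; set x := acts _ _ in tsu x0.
(* The path to [x] is nonempty, so by [ascending_size] its end root is not simple. *)
have xt : x != sroot t.
  apply/eqP => E; have := @ascending_size _ _ _ aP r t (s :: u) [::] asc isT E; by [].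
have := @root_refl_pos _ _ _ aP (word_elt (s :: u)) r t; rewrite act_word // => /(_ x0 xt) y0.
have yE : refl t x = act (cox_gen t * word_elt (s :: u))%g (sroot r).
  by rewrite actM // act_gen // act_word.
(* A path to [refl t x] prolonged by [t] is another path to [x], to be compared with [s :: u]. *)
rewrite yE in y0; have [u' [r' [asc' E]]] := ascending_exists aP y0.
rewrite -yE in E.
have E2 : acts (s :: u) (sroot r) = acts (t :: u') (sroot r') by rewrite /= E reflK.
have tasc : ascending r' (t :: u') by rewrite /= asc' E coord_refl_same // oppr_lt0 tsu.
have sz := ascending_size aP asc tasc E2.
have inf' : inf_path r' (t :: u').
  rewrite /inf_path tasc; apply/asboolP => fr'; move/asboolP: inf; apply.
  apply: (@fin_orbit_act _ _ _ aP r r' ((word_elt (t :: u'))^-1 * word_elt (s :: u))%g) => //.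
  by rewrite actM // !(act_word aP (s :: u)) E2 -(act_word aP) actK.
by have [] := common s u' r' t ru' inf' (esym (succn_inj sz)) E2.
Qed.

Lemma inf_orbit_leaf o : regular (Pal C) -> ~ fin_orbit o -> leaf a o.
Proof.
case/deep_paths=> N NP inf; apply: contraT => nl; exfalso.
pose path := fix path i : word C :=
  if i is j.+1 then pick_ascent o (acts (path j) (sroot o)) :: path j else [::].
pose s i := pick_ascent o (acts (path i) (sroot o)).
have pathP i : inf_path o (path i).
  elim: i => [|i IHi]; first by apply/andP; split=> //; apply/asboolP.
  exact: inf_path_child.
have szP i : size (path i) = i by elim: i => //= i ->.
pose v i t := coord t (acts (path i) (sroot o)).
have s_lt0 i : v i (s i) < 0 by apply: pick_ascentP.
apply: (@numbers_game_absurd R S _ a aP v s o N) => //.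
- by move=> t; rewrite /v /= coord_sroot.
- by move=> i t; rewrite /v /= coord_refl.
- move=> i; apply: (@coord_connect _ _ _ aP (word_elt (path i))).
  by rewrite act_word // lt_eqF //; apply: s_lt0.
- move=> i t Ni vt; have [|H _] := NP (path i) o _ (pathP i); first by rewrite szP.
  exact: H vt (s_lt0 i).
move=> i t Ni vt; have [|_ H] := NP (path i) o _ (pathP i); first by rewrite szP.
exact: H (s_lt0 i) vt.
Qed.

Lemma adj_m s t : s != t -> cox_m s t <> Some 2%N -> adj s t.
Proof. by move=> st m2; rewrite /adj st; apply/eqP => /(cartan_eq0 aP st). Qed.

(* An infinite orbit has an infinite ascending path, which in a component {o, b}
   can only alternate; when m o b = k is finite it stops after k - 1 steps. *)
Lemma inf_orbit_pair o : regular (Pal C) -> ~ fin_orbit o ->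
  exists2 b, b != o & cox_m o b = None /\
    (forall t, t != o -> t != b -> cox_m o t = Some 2%N /\ cox_m b t = Some 2%N).
Proof.
move=> reg inf; have /leafP lo := inf_orbit_leaf reg inf.
have inf0 u : ascending o u -> inf_path o u by move=> ou; apply/andP; split=> //; apply/asboolP.
have [b] := inf_path_ascent (inf0 [::] isT); rewrite /= coord_sroot => abo.
have bo : b != o by apply/eqP => E; move: abo; rewrite E (cartan_diag aP); lra.
have ob : adj o b by rewrite /adj eq_sym bo (cartan_sym aP) lt_eqF.
have infb : ~ fin_orbit b 
  by move=> fb; apply: inf; apply: (fin_orbit_adj aP) fb; rewrite (adj_sym aP).
have /leafP lb := inf_orbit_leaf reg infb.
have only t : connect adj o t -> (t == o) || (t == b).
  case/connectP=> w; suff : forall r, (r == o) || (r == b) -> path adj r w ->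
      (last r w == o) || (last r w == b).
    by move=> H ow ->; rewrite H ?eqxx.
  elim: w => //= t' w IHw r rob /andP[rt tw]; apply: IHw tw.
  case/orP: rob rt => /eqP-> rt; first by rewrite (lo t' b) ?eqxx ?orbT.
  by rewrite (lb t' o) ?eqxx // (adj_sym aP).
exists b => //; split; last first.
  move=> t to tb; split; apply: contrapT => /adj_m H.
    by case/eqP: tb; apply: lo => //; apply: H; rewrite eq_sym.
  by case/eqP: to; apply: lb; [apply: H; rewrite eq_sym | rewrite (adj_sym aP)].
case mE: (cox_m o b) => [k|//]; exfalso.
have [msym nz one] := cox_matrixP C.
(* The letter just applied pairs positively with the current root, so the next ascent is the other
   vertex. *)
have ascP n : ascending o (altw b o n).
  elim: n => // n IHn; have [t tn] := inf_path_ascent (inf0 _ IHn).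
  have tob : (t == o) || (t == b).
    apply: only; apply: (@coord_connect _ _ _ aP (word_elt (altw b o n))).
    by rewrite act_word // lt_eqF.
  suff -> : altw b o n.+1 = t :: altw b o n by rewrite /= tn.
  rewrite /=; congr (_ :: _); case: n IHn tn => [|n] /= IHn tn.
    case/orP: tob => /eqP // tE; move: tn.
    by rewrite tE coord_sroot (cartan_diag aP) => tn; exfalso; lra.
  case/andP: IHn => hd _; move: tn hd; set x := acts _ _; case: (odd n) => /= tn hd.
    case/orP: tob => /eqP // tE; move: tn.
    by rewrite tE coord_refl_same // => tn; exfalso; lra.
  case/orP: tob => /eqP // tE; move: tn.
  by rewrite tE coord_refl_same // => tn; exfalso; lra.
case: k mE => [/nz//|k mE]; have mE' : cox_m b o = Some k.+1 by rewrite msym.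
have [U0 _] := cartan_cheb0 aP bo mE'.
(* After [k] steps the root is a nonnegative multiple of the simple root of the next letter, which
   is therefore no ascent. *)
have := ascP k.+1; rewrite /= => /andP[+ _]; rewrite acts_altw // U0 scale0r add0r coordZ.
rewrite coord_sroot (cartan_diag aP); apply/negP; rewrite -leNgt mulr_ge0 //.
by apply: (cartan_cheb_ge0 aP bo) => j; rewrite mE' => -[<-].
Qed.

End Paths.

Close Scope ring_scope.

(** * The standard form over the reals *)

Local Open Scope ring_scope.

Section CosineMatrix.
Variable R : realType.

Lemma sin_cheb (x : R) j : sin x * cheb (2 * cos x) 0 1 j = sin (j%:R * x).
Proof.
suff: sin x * cheb (2 * cos x) 0 1 j = sin (j%:R * x) /\
      sin x * cheb (2 * cos x) 0 1 j.+1 = sin (j.+1%:R * x) by case.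
elim: j => [|j [IH1 IH2]]; first by split; rewrite /= ?mul0r ?mul1r ?mulr0 ?mulr1 ?sin0.
split=> //; rewrite chebS mulrBr mulrCA IH1 IH2.
have -> : j.+2%:R * x = j.+1%:R * x + x by rewrite -[j.+2]addn1 natrD mulrDl mul1r.
have -> : j%:R * x = j.+1%:R * x - x by rewrite -[j.+1]addn1 natrD mulrDl mul1r addrK.
by rewrite sinB sinD; ring.
Qed.

Lemma cheb2 j : cheb (2 : R) 0 1 j = j%:R.
Proof.
suff: cheb (2 : R) 0 1 j = j%:R /\ cheb (2 : R) 0 1 j.+1 = j.+1%:R by case.
elim: j => [|j [IH1 IH2]] //; split=> //; rewrite chebS IH1 IH2.
by rewrite -[j.+2]addn2 -[j.+1]addn1 !natrD; ring.
Qed.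

Definition cosine_matrix (S : finType) (m : S -> S -> option nat) (s t : S) : R :=
  if s == t then 2 else if m s t is Some k then - (2 * cos (pi / k%:R)) else -2.

(** Through [sin_cheb] the conditions on [cheb] become sin pi = 0, sin (pi + x) = - sin x and
    nonnegativity of the sine on [0, pi]. An infinite label is the limit case [cheb2]. *)
Lemma cosine_matrixP (S : finType) (m : S -> S -> option nat) :
  coxeter_matrix m -> cartan m (cosine_matrix m).
Proof.
move=> [msym nz one].
have angle s t k : s != t -> m s t = Some k -> [/\ (1 < k)%N, 0 < pi / k%:R :> R,
    pi / k%:R < pi :> R & pi / k%:R <= pi / 2 :> R].
  move=> st; case: k => [/nz//|[/one/eqP|k _]]; first by rewrite (negPf st).
  have k0 : (2 : R) <= k.+2%:R by rewrite ler_nat.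
  have p0 := pi_gt0 R; have k1 : (0 : R) < k.+2%:R by rewrite ltr0n.
  split=> //; first exact: divr_gt0.
    by rewrite ltr_pdivrMr //; nra.
  by rewrite ler_pM2l // lef_pV2 ?posrE.
have cos_ge0 s t k : s != t -> m s t = Some k -> 0 <= cos (pi / k%:R) :> R.
  move=> st /(angle _ _ _ st)[_ h1 _ h2]; apply: cos_ge0_pihalf; rewrite h2 andbT.
  by have := pi_gt0 R; lra.
have sin_gt0 s t k : s != t -> m s t = Some k -> 0 < sin (pi / k%:R) :> R.
  by move=> st /(angle _ _ _ st)[_ h1 h2 _]; apply: sin_gt0_pi; rewrite h1.
have kpi k : k.+1%:R * (pi / k.+1%:R) = pi :> R by rewrite mulrC divfK ?pnatr_eq0.
split.
- by move=> s t; rewrite /cosine_matrix eq_sym msym.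
- by move=> s; rewrite /cosine_matrix eqxx.
- move=> s t st; rewrite /cosine_matrix (negPf st).
  case mst: (m s t) => [k|]; last by lra.
  by have := cos_ge0 _ _ _ st mst; lra.
- move=> s t st; rewrite /cosine_matrix (negPf st).
  case mst: (m s t) => [k|]; last by split=> // /eqP; rewrite oppr_eq0 (pnatr_eq0 R 2).
  have [k1 h1 _ _] := angle _ _ _ st mst; split=> [/eqP|[->]]; last first.
    by rewrite cos_pihalf mulr0 oppr0.
  rewrite oppr_eq0 mulf_eq0 pnatr_eq0 /=; case: (ltngtP k 2) => [|k2|->//]; first by lia.
  rewrite gt_eqF // cos_gt0_pihalf //; apply/andP; split; first by have := pi_gt0 R; lra.
  by rewrite ltr_pM2l ?pi_gt0 // ltf_pV2 ?posrE ?ltr0n ?ltr_nat //; lia.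
- move=> s t k st mst; rewrite /cosine_matrix (negPf st) mst.
  have := sin_gt0 _ _ _ st mst; have := cos2Dsin2 (pi / k.+1%:R : R).
  by have := cos_ge0 _ _ _ st mst; nra.
- move=> s t k st mst; rewrite /cosine_matrix (negPf st) mst opprK.
  have s0 := sin_gt0 _ _ _ st mst.
  have s1 : sin (pi / k.+1%:R : R) != 0 by rewrite gt_eqF.
  split; apply: (mulfI s1); rewrite sin_cheb.
    by rewrite kpi sinpi mulr0.
  by rewrite -[k.+2]addn1 natrD mulrDl kpi mul1r addrC sinDpi mulrN1.
move=> s t j st jm; rewrite /cosine_matrix (negPf st).
case mst: (m s t) => [k|]; last by rewrite opprK cheb2 ler0n.
have s0 := sin_gt0 _ _ _ st mst; have [k1 h1 _ _] := angle _ _ _ st mst.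
rewrite opprK -(pmulr_rge0 _ s0) sin_cheb; apply: sin_ge0_pi.
rewrite mulr_ge0 ?ler0n ?(ltW h1) //=.
have jk : (j <= k)%N by apply: jm.
case: k => // k in k1 mst s0 h1 jk *.
by rewrite -[X in _ <= X](kpi k) ler_pM2r // ler_nat.
Qed.

End CosineMatrix.

Close Scope ring_scope.

(** * Palindromes in products *)

Section Reduced.
Variable C : coxeterSystem.
Implicit Types (s t : cox_index C) (u v w : word C).

Lemma reduced_tail s w : reduced (s :: w) -> reduced w.
Proof.
rewrite /reduced word_cons /= => /eqP sw.
have := ellM (cox_gen s) (word_elt w); have := ell_word w; rewrite ell_gen.
by rewrite -sw; lia.
Qed.

Lemma reduced_sorted w : reduced w -> sorted (fun s t => s != t) w.
Proof.
elim: w => // s [|t w] IHw // red; have := IHw (reduced_tail red) => /= ->.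
rewrite andbT; apply/eqP => st; move: red; rewrite -st /reduced !word_cons gen_mulKV /=.
by have := ell_word w => h /eqP E; move: h; rewrite -E; lia.
Qed.

(** The halves of an even palindrome are mutually reverse, hence represent inverse elements; the
    word represents 1. *)
Lemma even_Pal w : Pal C w -> ~~ odd (size w) -> w = [::].
Proof.
case/andP=> /eqP red pal ev; apply: size0nil; rewrite red.
have [h wE] : exists h, size w = (h + h)%N.
  by exists (size w)./2; rewrite addnn -[LHS]odd_double_half (negPf ev).
have sz : size (rev (drop h w)) = size (take h w).
  by rewrite size_rev size_drop size_take wE; case: ltnP; lia.
have : rev (drop h w) ++ rev (take h w) == take h w ++ drop h w.
  by rewrite -rev_cat cat_take_drop.
rewrite eqseq_cat // => /andP[_ /eqP E].
by rewrite -[w](cat_take_drop h) -E word_cat word_rev mulgV ell1.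
Qed.

End Reduced.

Section Transfer.
Variables (C D : coxeterSystem).

Lemma regular_Pal_iso : cox_isomorphic C D -> regular (Pal D) -> regular (Pal C).
Proof.
case=> phi [f [bphi [g fK gK] phif fm]] [M MP].
have wordE (w : word C) : word_elt (map f w : word D) = phi (word_elt w).
  by rewrite /word_elt big_map gmulf_prod; apply: eq_bigr => s _; rewrite phif.
have lenE x : cox_length (phi x) = cox_length x.
  apply/eqP; rewrite eqn_leq; apply/andP; split.
    have [u <- <-] := reduced_word x; rewrite -wordE.
    by rewrite (leq_trans (ell_word _)) // size_map.
  have [v vx <-] := reduced_word (phi x).
  have vE : v = map f (map g v) by rewrite -map_comp (eq_map gK) map_id.
  have <- : word_elt (map g v : word C) = x by apply: (bij_inj bphi); rewrite -wordE -vE.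
  by rewrite (leq_trans (ell_word _)) // size_map.
exists (@DFA _ (dfa_state M) (dfa_start M) (@dfa_final _ M) (fun q s => dfa_trans q (f s))) => w.
have -> : Pal C w = Pal D (map f w).
  rewrite /Pal /= /reduced wordE lenE size_map /palindromic -map_rev.
  by rewrite (inj_eq (inj_map (can_inj fK))).
rewrite MP /dfa_accepts /=; congr dfa_final.
by elim: w (dfa_start M) => //= s w IHw q; rewrite IHw.
Qed.

Let P := cox_prod C D.
Implicit Type w : word P.

Definition lefts w : word C := pmap (fun x => if x is inl s then Some s else None) w.
Definition rights w : word D := pmap (fun x => if x is inr s then Some s else None) w.

Lemma size_lefts_rights w : (size (lefts w) + size (rights w))%N = size w.
Proof. by elim: w => //= -[s|s] w IHw /=; lia. Qed.

Lemma word_elt_prod w : word_elt w = (word_elt (lefts w), word_elt (rights w)) :> (C * D)%type.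
Proof.
elim: w => [|[s|s] w IHw] /=; first by rewrite !word_nil.
  by rewrite !word_cons IHw /= -[(_ * _)%g]/((_ * _)%g, (1 * _)%g) mul1g.
by rewrite !word_cons IHw /= -[(_ * _)%g]/((1 * _)%g, (_ * _)%g) mul1g.
Qed.

Lemma lefts_inl (u : word C) : lefts (map inl u) = u.
Proof. by elim: u => //= s u ->. Qed.

Lemma rights_inr (u : word D) : rights (map inr u) = u.
Proof. by elim: u => //= s u ->. Qed.

Lemma lefts_inr (u : word D) : lefts (map inr u) = [::].
Proof. by elim: u. Qed.

Lemma rights_inl (u : word C) : rights (map inl u) = [::].
Proof. by elim: u. Qed.

Lemma rights_nil w : rights w = [::] -> w = map inl (lefts w).
Proof. by elim: w => //= -[s|s] w IHw //= /IHw {1}->. Qed.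

Lemma lefts_nil w : lefts w = [::] -> w = map inr (rights w).
Proof. by elim: w => //= -[s|s] w IHw //= /IHw {1}->. Qed.

Lemma lefts_rev w : lefts (rev w) = rev (lefts w).
Proof.
elim: w => //= x w IHw; rewrite rev_cons -cats1 /lefts pmap_cat -!/(lefts _) IHw.
by case: x => s /=; rewrite ?cats0 // rev_cons cats1.
Qed.

Lemma rights_rev w : rights (rev w) = rev (rights w).
Proof.
elim: w => //= x w IHw; rewrite rev_cons -cats1 /rights pmap_cat -!/(rights _) IHw.
by case: x => s /=; rewrite ?cats0 // rev_cons cats1.
Qed.

Lemma ell_prod (x : C) (y : D) :
  cox_length ((x, y) : P) = (cox_length x + cox_length y)%N.
Proof.
apply/eqP; rewrite eqn_leq; apply/andP; split.
  have [u ux <-] := reduced_word x; have [v vy <-] := reduced_word y.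
  have <- : word_elt (map inl u ++ map inr v : word P) = (x, y).
    rewrite word_elt_prod /lefts /rights !pmap_cat -!/(lefts _) -!/(rights _).
    by rewrite lefts_inl lefts_inr rights_inl rights_inr cats0 /= ux vy.
  by rewrite (leq_trans (ell_word _)) // size_cat !size_map.
have [w + <-] := reduced_word ((x, y) : P); rewrite word_elt_prod => -[<- <-].
by rewrite -size_lefts_rights leq_add ?ell_word.
Qed.

Lemma reduced_prod w : reduced w = reduced (lefts w) && reduced (rights w).
Proof.
rewrite /reduced word_elt_prod ell_prod -size_lefts_rights.
have := ell_word (lefts w); have := ell_word (rights w).
move: (size _) (size _) (cox_length _) (cox_length _) => n1 n2 n3 n4; lia.
Qed.

(* A reduced palindrome of even length is empty, and the two projections of a
   nonempty one cannot both have odd length. *)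
Lemma Pal_prod w : Pal P w = (rights w == [::]) && Pal C (lefts w) ||
                             (lefts w == [::]) && Pal D (rights w).
Proof.
apply/idP/orP.
  move=> pw; have /andP[red pal] := pw.
  move: red; rewrite reduced_prod => /andP[redl redr].
  have pl : Pal C (lefts w).
    by apply/andP; split=> //; rewrite /palindromic -lefts_rev (eqP pal).
  have pr : Pal D (rights w).
    by apply/andP; split=> //; rewrite /palindromic -rights_rev (eqP pal).
  have [or|/(even_Pal pr) r0] := boolP (odd (size (rights w))); last by left; rewrite r0 eqxx.
  have [ol|/(even_Pal pl) l0] := boolP (odd (size (lefts w))); last by right; rewrite l0 eqxx.
  have ev : ~~ odd (size w) by rewrite -size_lefts_rights oddD ol or.
  by move: or; rewrite (even_Pal pw ev).
case=> /andP[/eqP E /andP[red pal]]; apply/andP; rewrite reduced_prod red E /=.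
  split; first by rewrite /reduced word_nil ell1.
  by rewrite /palindromic {1}(rights_nil E) -map_rev (eqP pal) -rights_nil.
rewrite andbT; split; first by rewrite /reduced word_nil ell1.
by rewrite /palindromic {1}(lefts_nil E) -map_rev (eqP pal) -lefts_nil.
Qed.

Lemma regular_Pal_prod : regular (Pal C) -> regular (Pal D) -> regular (Pal P).
Proof.
case=> M1 M1P [M2 M2P].
(* Each flag records whether a letter of its factor has been read, that is, whether that projection
   is nonempty. *)
pose tr (q : (dfa_state M1 * bool) * (dfa_state M2 * bool)) (x : cox_index P) :=
  match x with
  | inl s => ((dfa_trans q.1.1 s, true), q.2)
  | inr s => (q.1, (dfa_trans q.2.1 s, true))
  end.
pose fin (q : (dfa_state M1 * bool) * (dfa_state M2 * bool)) :=
  ~~ q.2.2 && dfa_final q.1.1 || ~~ q.1.2 && dfa_final q.2.1.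
exists (@DFA _ _ ((dfa_start M1, false), (dfa_start M2, false)) fin tr) => w.
rewrite Pal_prod M1P M2P /dfa_accepts /=.
have runE q1 b1 q2 b2 : foldl tr ((q1, b1), (q2, b2)) w =
    ((foldl (@dfa_trans _ M1) q1 (lefts w), b1 || (lefts w != [::])),
     (foldl (@dfa_trans _ M2) q2 (rights w), b2 || (rights w != [::]))).
  elim: w q1 b1 q2 b2 => [|[s|s] w IHw] q1 b1 q2 b2 /=; rewrite ?orbF //.
    by rewrite IHw /= orbT.
  by rewrite IHw /= orbT.
by rewrite runE /fin /= !negbK.
Qed.

End Transfer.

Lemma bounded_regular (A : finType) (L : pred (seq A)) N :
  (forall w, L w -> size w <= N)%N -> regular L.
Proof.
(* The states are the words of size at most [N]; [None] is the sink for longer ones. *)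
move=> LN; pose tr (q : option (N.-bseq A)) x : option (N.-bseq A) :=
  if q is Some u then insub (rcons u x) else None.
exists (@DFA _ _ (insub [::])
  (fun q : option (N.-bseq A) => if q is Some u then L u else false) tr) => w.
have runE u : foldl tr (insub u) w = insub (u ++ w).
  elim: w u => [|x w IHw] u; first by rewrite cats0.
  rewrite /= -cat_rcons -IHw; congr foldl; case: (insubP _ u) => [v _ <- //|us] /=.
  by rewrite insubN // size_rcons; apply: contra us; apply: ltnW.
rewrite /dfa_accepts /= runE cat0s; case: insubP => [v _ -> //|wN].
by apply/negP => /LN wN'; rewrite wN' in wN.
Qed.

Lemma regular_Pal_finite (C : coxeterSystem) : finite_coxeter C -> regular (Pal C).
Proof.
case=> r rC; apply: (@bounded_regular _ _ (\max_(x <- r) cox_length x)) => w /andP[/eqP-> _].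
exact: leq_bigmax_seq.
Qed.

(** * The infinite dihedral group *)

Local Open Scope ring_scope.

Section DihedralPal.
Variables (R : realFieldType) (C : coxeterSystem) (a : cox_index C -> cox_index C -> R).
Hypothesis aP : cartan (@cox_m C) a.
Implicit Types (r s t : cox_index C) (w : word C).

Lemma ell_altw r s k : r != s -> (forall m, cox_m r s = Some m -> (k <= m)%N) ->
  cox_length (word_elt (altw r s k)) = k.
Proof.
elim: k r s => [|k IHk] r s rs km; first by rewrite word_nil ell1.
have sr : s != r by rewrite eq_sym.
have [msym _ _] := cox_matrixP C.
have km' m : cox_m s r = Some m -> (k < m)%N by rewrite msym => /km.
have [p [q [p0 q0 E]]] := pos_altw aP sr km'.
have IH : cox_length (word_elt (altw s r k)) = k by apply: IHk => // m /km'/ltnW.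
rewrite altw_rcons word_rcons -[in RHS]IH; apply: ell_up.
by rewrite -(act_posE aP) act_word // E posD // posZ ?pos_sroot.
Qed.

Lemma palindromic_altw r s k : palindromic (altw r s (k + k).+1).
Proof.
elim: k r s => [|k IHk] r s; first exact: eqxx.
rewrite addSn addnS.
have -> : altw r s (k + k).+3 = r :: rcons (altw s r (k + k).+1) r.
  by rewrite -altw_rcons [LHS]/= addnn /= odd_double.
by rewrite /palindromic rev_cons rev_rcons (eqP (IHk s r)) rcons_cons.
Qed.

Lemma alternating_altw w r s : (forall t, (t == r) || (t == s)) -> r != s ->
  sorted (fun s t => s != t) (rcons w r) -> rcons w r = altw r s (size w).+1.
Proof.
move=> rst rs; elim: w => // x w IHw /= srt.
have {}IHw := IHw (path_sorted srt); move: srt; rewrite IHw /= => /andP[+ _] => xs.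
congr (_ :: _); move: xs; case: (odd _) => /= xs.
  by case/orP: (rst x) => /eqP // xE; rewrite xE eqxx in xs.
by case/orP: (rst x) => /eqP // xE; rewrite xE eqxx in xs.
Qed.

(** With two letters and no finite label every alternating word is reduced, and an alternating word
    of odd size is a palindrome. *)
Lemma Pal_dihedral w : infinite_dihedral C ->
  Pal C w = (w == [::]) || sorted (fun s t => s != t) w && odd (size w).
Proof.
case=> card2 inf; apply/idP/orP => [pw|[/eqP->|/andP[srt ow]]].
- have [ow|/(even_Pal pw)->] := boolP (odd (size w)); last by left.
  by right; rewrite reduced_sorted //; case/andP: pw.
- by apply/andP; split=> //; rewrite /reduced word_nil ell1.
case/lastP: w srt ow => // w r srt ow.
have [s sr] : exists s, s != r.
  apply/existsP; apply: contraT; rewrite negb_exists => /forallP H.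
  have : (#|cox_index C| <= 1)%N.
    by apply/card_le1_eqP => x y _ _; have := H x; have := H y; rewrite !negbK => /eqP-> /eqP->.
  by rewrite card2.
have rs : r != s by rewrite eq_sym.
have rst t : (t == r) || (t == s).
  apply: contraT; rewrite negb_or => /andP[tr ts].
  have : (#|[set r; s; t]| <= 2)%N by rewrite -card2 max_card.
  by rewrite -setUA cardsU1 cardsU1 cards1 !inE negb_or rs (eq_sym r t) (eq_sym s t) tr ts.
rewrite (alternating_altw rst rs srt).
have [k kE] : exists k, size w = (k + k)%N.
  exists (size w)./2.
  move: ow; rewrite size_rcons /=; have := odd_double_half (size w).
  by case: odd => //=; lia.
apply/andP; split; last by rewrite kE palindromic_altw.
rewrite /reduced size_altw ell_altw // => m; rewrite inf //.
exact/eqP.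
Qed.

Lemma regular_Pal_dihedral : infinite_dihedral C -> regular (Pal C).
Proof.
(* [None] is the sink after a repeated letter and [Some None] stands for the empty word; otherwise
   the last letter and the parity of the size are kept. *)
move=> dih; pose tr (q : option (option (cox_index C * bool))) x :=
  match q with
  | None => None
  | Some None => Some (Some (x, true))
  | Some (Some (y, b)) => if y == x then None else Some (Some (x, ~~ b))
  end.
pose fin (q : option (option (cox_index C * bool))) :=
  match q with None => false | Some None => true | Some (Some (_, b)) => b end.
exists (@DFA _ _ (Some None) fin tr) => w; rewrite Pal_dihedral // /dfa_accepts /=.
have dead w' : foldl tr None w' = None by elim: w'.
have runE y b w' : foldl tr (Some (Some (y, b))) w' =
    if path (fun s t => s != t) y w' then Some (Some (last y w', b (+) odd (size w'))) else None.
  elim: w' y b => [|x w' IHw] y b /=; first by rewrite addbF.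
  by case: eqVneq => /= [_|_]; rewrite ?dead // IHw addNb addbN.
by case: w => //= x w; rewrite runE /=; case: path.
Qed.

End DihedralPal.

(** * From finite orbits to a finite group *)

Section FiniteOrbits.
Variables (R : realFieldType) (C : coxeterSystem) (a : cox_index C -> cox_index C -> R).
Hypothesis aP : cartan (@cox_m C) a.
Local Notation S := (cox_index C).
Local Notation V := {ffun S -> R^o}.

Lemma act_sum (g : C) (x : V) : act a g x = \sum_r (x r : R) *: act a g (sroot R r).
Proof.
have xE : x = \sum_r (x r : R) *: sroot R r.
  apply/ffunP => t; rewrite sum_ffunE (bigD1 t) //= big1 => [|r rt].
    by rewrite addr0 vecZ srootE eqxx mulr1.
  by rewrite vecZ srootE eq_sym (negPf rt) mulr0.
have act0 : act a g 0 = 0 by rewrite -(scale0r (0 : V)) actZ !scale0r.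
by rewrite {1}xE (big_morph _ (actD a g) act0); apply: eq_bigr => r _; rewrite actZ.
Qed.

(** By faithfulness an element is determined by the images of the simple roots, which lie in finite
    lists. *)
Lemma fin_orbits_finite : (forall r, fin_orbit a r) -> finite_coxeter C.
Proof.
move=> /choice[l lP]; pose L := flatten [seq l r | r <- enum S].
have LP g r : act a g (sroot R r) \in L.
  by apply/flatten_mapP; exists r; rewrite ?mem_enum.
pose h g : {ffun S -> seq_sub L} := [ffun r => SeqSub (LP g r)].
have h_inj : injective h.
  move=> g g' /ffunP gg'; apply: (act_faithful aP) => x; rewrite !act_sum.
  by apply: eq_bigr => r _; have := gg' r; rewrite !ffunE => -[->].
(* A left inverse of [h], with default 1 outside its range. *)
pose back (q : {ffun S -> seq_sub L}) : C :=
  if pselect (exists g, h g = q) is left e then sval (cid e) else 1%g.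
exists [seq back q | q <- enum {: {ffun S -> seq_sub L}}] => g; apply/mapP.
exists (h g); first by rewrite mem_enum.
rewrite /back; case: pselect => [e|[]]; last by exists g.
by apply: h_inj; case: (cid e).
Qed.

End FiniteOrbits.

Close Scope ring_scope.

(** * The decomposition *)

Section Restriction.
Variables (S : finType) (m : S -> S -> option nat) (J : pred S).

Definition restricted_matrix (s t : {t | J t}) : option nat := m (val s) (val t).

Lemma restricted_matrixP : coxeter_matrix m -> coxeter_matrix restricted_matrix.
Proof.
move=> [msym nz one]; split=> s t; [exact: msym | exact: nz |].
by split=> [/one/val_inj|->]; last exact/one.
Qed.

End Restriction.

Local Open Scope ring_scope.

Section FiniteFactor.
Variables (R : realFieldType) (C : coxeterSystem) (a : cox_index C -> cox_index C -> R).
Hypothesis aP : cartan (@cox_m C) a.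
Variable J : pred (cox_index C).
Hypothesis J_closed : forall s t, J s -> adj a s t -> J t.
Hypothesis J_fin : forall s, J s -> fin_orbit a s.

Let F := presented_system (restricted_matrixP J (cox_matrixP C)).
Let aF (s t : cox_index F) : R := a (val s) (val t).

Let aFP : cartan (@cox_m F) aF.
Proof.
have neq (s t : cox_index F) : s != t -> val s != val t by rewrite (inj_eq val_inj).
split.
- by move=> s t; apply: (cartan_sym aP).
- by move=> s; apply: (cartan_diag aP).
- by move=> s t /neq; apply: (cartan_le0 aP).
- by move=> s t /neq; apply: (cartan_eq0 aP).
- by move=> s t k /neq; apply: (cartan_gt aP).
- by move=> s t k /neq; apply: (cartan_cheb0 aP).
by move=> s t j /neq; apply: (cartan_cheb_ge0 aP).
Qed.

Let restr (x : {ffun cox_index C -> R^o}) : {ffun cox_index F -> R^o} := [ffun s => x (val s)].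

Let restrE x s : restr x s = x (val s) :> R.
Proof. by rewrite ffunE. Qed.

Let coord_restr s x : coord aF s (restr x) = coord a (val s) x.
Proof.
rewrite /coord (bigID J) /= [X in _ = _ + X]big1 ?addr0 => [|t Jt].
  under eq_bigr do rewrite restrE.
  exact: esym (big_sub J (fun t => a (val s) t * (x t : R))).
have [->|] := eqVneq (a (val s) t) 0; first by rewrite mul0r.
move=> ast; have st : adj a (val s) t.
  rewrite /adj ast andbT; apply: contraNneq Jt => <-; exact: (valP s).
by rewrite (J_closed (valP s) st) in Jt.
Qed.

(** As [J] is closed under adjacency, restriction to [J] intertwines the reflections, so the roots
    of [F] are restrictions of roots in finite orbits. *)
Lemma presented_restriction_finite : finite_coxeter F.
Proof.
apply: (fin_orbits_finite aFP) => r; have [l lP] := J_fin (valP r).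
exists (map restr l) => g; apply/mapP.
exists (acts a (map val (word_of g)) (sroot R (val r))).
  by rewrite -(act_word aP).
rewrite /act; elim: (word_of g) => [|s u IHu] /=.
  by apply/ffunP => t; rewrite restrE srootE [LHS]srootE (inj_eq val_inj).
apply/ffunP => t; rewrite IHu restrE reflE [LHS]reflE coord_restr restrE.
by rewrite (inj_eq val_inj).
Qed.

End FiniteFactor.

Definition infinite_matrix (b c : bool) : option nat := if b == c then Some 1%N else None.

Lemma infinite_matrixP : coxeter_matrix infinite_matrix.
Proof. by split=> [[] []|[] []|[] []]. Qed.

Definition dihedral_system : coxeterSystem := presented_system infinite_matrixP.

Lemma dihedral_system_infinite : infinite_dihedral dihedral_system.
Proof. by split=> [|[] []]; first exact: card_bool. Qed.

Section Pairing.
Variables (S : finType) (m : S -> S -> option nat) (J : pred S) (partner : S -> S).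
Hypothesis mP : coxeter_matrix m.
Hypothesis partner_neq : forall t, ~~ J t -> partner t != t.
Hypothesis partnerJ : forall t, ~~ J t -> ~~ J (partner t).
Hypothesis partner_m : forall t, ~~ J t -> m t (partner t) = None.
Hypothesis partner_comm : forall t q, ~~ J t -> q != t -> q != partner t ->
  m t q = Some 2%N /\ m (partner t) q = Some 2%N.

(** Otherwise [partner (partner t)] would commute with [partner t], to which it is joined by an
    infinite label. *)
Let partnerK t : ~~ J t -> partner (partner t) = t.
Proof.
move=> Jt; apply/eqP; apply: contraT => pt.
have [_] := partner_comm Jt pt (partner_neq (partnerJ Jt)).
by rewrite partner_m // partnerJ.
Qed.

Let power (F : coxeterSystem) k := iter k (fun P => cox_prod P dihedral_system) F.

(** Pairs of partners are added one at a time as dihedral factors. The image stays closed under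
    [partner] outside [J], so an uncovered vertex has an uncovered partner; [n] bounds the number of
    uncovered vertices. *)
Lemma pairing_product (F : coxeterSystem) (g : cox_index F -> S) :
  injective g -> (forall s t, m (g s) (g t) = cox_m s t) -> (forall t, (t \in codom g) = J t) ->
  exists k (f : cox_index (power F k) -> S),
    bijective f /\ forall s t, m (f s) (f t) = cox_m s t.
Proof.
have [msym _ one] := mP.
move=> g_inj gm gJ.
suff ext n k (f : cox_index (power F k) -> S) : (#|[predC codom f]| <= n)%N -> injective f ->
    (forall s t, m (f s) (f t) = cox_m s t) -> (forall t, J t -> t \in codom f) ->
    (forall t, ~~ J t -> t \in codom f -> partner t \in codom f) ->
    exists k (f : cox_index (power F k) -> S),
      bijective f /\ forall s t, m (f s) (f t) = cox_m s t.
  apply: (ext #|S| 0%N g) => //; first exact: max_card.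
    by move=> t; rewrite gJ.
  by move=> t /negPf Jt; rewrite gJ Jt.
elim: n k f => [|n IHn] k f fn f_inj fm fJ fp;
    have [/pred0P all|] := boolP (pred0b [predC codom f]).
- exists k, f; split=> //; have fS t : t \in codom f by have /= /negbFE := all t.
  exists (fun t => iinv (fS t)) => [x|t]; last exact: f_iinv.
  by apply: f_inj; rewrite f_iinv.
- by rewrite /pred0b -leqn0 fn.
- by apply: IHn fm fJ fp => //; rewrite eq_card0.
case/pred0Pn => t /= tf; have Jt : ~~ J t by apply: contra tf; apply: fJ.
have ptf : partner t \notin codom f.
  by apply: contra tf => /(fp _ (partnerJ Jt)); rewrite partnerK.
pose f' (x : cox_index (power F k.+1)) : S :=
  match x with inl i => f i | inr b => if b then t else partner t end.
have f'l i : f' (inl i) \in codom f by apply: codom_f.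
have f'r b : f' (inr b) \notin codom f by case: b.
have codomE q : (q \in codom f') = [|| q \in codom f, q == t | q == partner t].
  apply/codomP/or3P => [[[i|[]] ->]|[/codomP[i ->]|/eqP->|/eqP->]].
  - by apply: Or31; apply: codom_f.
  - by apply: Or32.
  - by apply: Or33.
  - by exists (inl i).
  - by exists (inr true).
  - by exists (inr false).
have comm i : m (f i) t = Some 2%N /\ m (f i) (partner t) = Some 2%N.
  rewrite msym (msym _ (partner t)); apply: partner_comm => //.
    by apply: contraNneq tf => <-; apply: codom_f.
  by apply: contraNneq ptf => <-; apply: codom_f.
apply: (IHn k.+1 f').
- rewrite -ltnS (leq_trans _ fn) //; apply: proper_card; apply/properP; split.
    by apply/subsetP => q; rewrite !inE codomE negb_or => /andP[].
  by exists t; rewrite ?inE ?codomE ?eqxx ?orbT.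
- move=> [i|b] [i'|b'] E.
  + by congr inl; apply: f_inj.
  + by have := f'r b'; rewrite -E f'l.
  + by have := f'r b; rewrite E f'l.
  congr inr; case: b b' E => -[] //= E; have := partner_neq Jt.
    by rewrite -E eqxx.
  by rewrite E eqxx.
- move=> [i|b] [i'|b'] /=.
  + exact: fm.
  + by case: b'; have [] := comm i.
  + by rewrite msym; case: b; have [] := comm i'.
  case: b b' => -[]; rewrite /infinite_matrix /=; try exact/one.
    exact: partner_m.
  by rewrite msym partner_m.
- by move=> q Jq; rewrite codomE fJ.
move=> q Jq; rewrite !codomE => /or3P[/(fp _ Jq)->//|/eqP->|/eqP->].
  by rewrite eqxx !orbT.
by rewrite partnerK // eqxx !orbT.
Qed.

End Pairing.

Lemma regular_Pal_power (F D : coxeterSystem) k :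
  finite_coxeter F -> infinite_dihedral D ->
  regular (Pal (iter k (fun P => cox_prod P D) F)).
Proof.
move=> finF dihD; elim: k => [|k IHk]; first exact: regular_Pal_finite.
apply: regular_Pal_prod IHk _.
exact: (regular_Pal_dihedral (cosine_matrixP (Rdefinitions.R : realType) (cox_matrixP D)) dihD).
Qed.

Lemma regular_Pal_factor (C : coxeterSystem) : regular (Pal C) ->
  exists (F D : coxeterSystem) (k : nat),
    [/\ finite_coxeter F, infinite_dihedral D
      & cox_isomorphic C (iter k (fun P => cox_prod P D) F)].
Proof.
move=> reg; have mP := cox_matrixP C; have [msym _ _] := mP.
have aP := cosine_matrixP (Rdefinitions.R : realType) mP; set a := cosine_matrix _ _ in aP.
pose J t : bool := `[< fin_orbit a t >].
have J_closed s t : J s -> adj a s t -> J t.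
  by move=> /asboolP fs st; apply/asboolP; apply: (fin_orbit_adj aP st).
have J_fin s : J s -> fin_orbit a s by move/asboolP.
have partner_ex t : exists b, ~~ J t -> [/\ b != t, cox_m t b = None &
    forall q, q != t -> q != b -> cox_m t q = Some 2%N /\ cox_m b q = Some 2%N].
  (* On [J] the partner is a dummy value. *)
  have [Jt|/asboolPn inf] := boolP (J t); first by exists t.
  by have [b bt [mtb comm]] := inf_orbit_pair aP reg inf; exists b.
have [partner partnerP] := choice partner_ex.
have partnerJ t : ~~ J t -> ~~ J (partner t).
  move=> Jt; have [bt mtb _] := partnerP t Jt; apply: contra Jt => Jb.
  by apply: J_closed Jb _; apply: (adj_m aP bt); rewrite msym mtb.
pose F := presented_system (restricted_matrixP J mP).
have codomF t : (t \in codom (val : cox_index F -> cox_index C)) = J t.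
  apply/codomP/idP => [[s ->]|Jt]; first exact: (valP s).
  by exists (Sub t Jt); rewrite SubK.
have [k [f [f_bij fm]]] := @pairing_product _ _ J partner mP
  (fun t Jt => let: And3 h _ _ := partnerP t Jt in h) partnerJ
  (fun t Jt => let: And3 _ h _ := partnerP t Jt in h)
  (fun t q Jt => let: And3 _ _ h := partnerP t Jt in h q)
  F val val_inj (fun s t => erefl) codomF.
exists F, dihedral_system, k; split.
- exact: (presented_restriction_finite aP J_closed J_fin).
- exact: dihedral_system_infinite.
case: (f_bij) => g fK gK; apply: (@cox_iso_of_matrix _ _ g); first by exists f.
by move=> s t; rewrite -fm !gK.
Qed.

Close Scope ring_scope.

Theorem theorem1p1 (C : coxeterSystem) :
  regular (Pal C) <->
  exists (F D : coxeterSystem) (k : nat),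
    [/\ finite_coxeter F, infinite_dihedral D
      & cox_isomorphic C (iter k (fun P => cox_prod P D) F)].
Proof.
split; first exact: regular_Pal_factor.
case=> F [D [k [finF dihD iso]]].
exact: regular_Pal_iso iso (regular_Pal_power k finF dihD).
Qed.
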